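(* Let $m\ge2$ and $f\in L^2(I)$, and let $u\in V$ be the weak solution of $-(\omega u')'=f$ in $I$, $u(\pm1)=0$, i.e. $a(u,v)=(f,v)$ for all $v\in V$; assume $u\in H^m(I)\cap H^1_{0,\omega}(I)$. For $N\ge2$ let $u_N\in V_N$ be the discrete solution, i.e. $a(u_N,v)=(f,v)$ for all $v\in V_N$. Then there is a constant $C$ independent of $N$ and $u$ such that $$\|u-u_N\|_V\le C N^{1-m}\|u\|_{H^m(I)}\qquad\text{and}\qquad \|u-u_N\|_{L^2(I)}\le C N^{-m}\|u\|_{H^m(I)}.$$
   Context: $I=(-1,1)$, $\omega(x)=\sqrt{1-x^2}$. $V=H^1_{0,\omega}(I)$ is the closure of $C_0^\infty(I)$ with respect to the norm $\big(\int_I (|u|^2+\omega|u'|^2)\,\mathrm dx\big)^{1/2}$, equipped with $\|u\|_V=\big(\int_I\omega|u'|^2\,\mathrm dx\big)^{1/2}$. $a(u,v)=\int_I\omega u'v'\,\mathrm dx$ and $(f,v)=\int_I fv\,\mathrm dx$. With $T_k$ the Chebyshev polynomial of the first kind of degree $k$, $\phi_n=T_{n+2}-T_n$ and $V_N=\mathrm{span}\{\phi_0,\dots,\phi_{N-2}\}$ (polynomials of degree $\le N$ vanishing at $\pm1$). $H^m(I)$ is the standard Sobolev space with norm $\|\cdot\|_{H^m(I)}$. *)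

(* Defs.v *)
From HB Require Import structures.
From mathcomp Require Import all_boot all_order all_algebra.
From mathcomp Require Import all_classical all_reals all_analysis.
Set Implicit Arguments. Unset Strict Implicit. Unset Printing Implicit Defensive.
Import Order.TTheory GRing.Theory Num.Theory numFieldNormedType.Exports.
Local Open Scope classical_set_scope.
Local Open Scope ring_scope.

Section Defs.
Variable R : realType.
Notation mu := (@lebesgue_measure R).

Definition I : set R := `](-1), 1[.

Definition omega (x : R) : R := Num.sqrt (1 - x ^+ 2).

Definition intI (f : R -> R) : R := \int[mu]_(x in I) f x.

Definition L2 (f : R -> R) : Prop :=
  measurable_fun I f /\ (\int[mu]_(x in I) ((f x) ^+ 2)%:E < +oo)%E.

Definition test_fun (phi : R -> R) : Prop :=
  (forall n x, derivable (derive1n n phi) x 1) /\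
  exists a b : R, -1 < a /\ b < 1 /\
    forall x, (x < a \/ b < x) -> phi x = 0.

(* H^1_{0,omega}(I): u (with its derivative du) belongs to the closure of
   C_0^infty(I) for the norm (int_I |u|^2 + omega |u'|^2)^{1/2}. *)
Definition in_V (u du : R -> R) : Prop :=
  measurable_fun I u /\ measurable_fun I du /\
  exists phi : nat -> R -> R, (forall n, test_fun (phi n)) /\
    ((fun n => \int[mu]_(x in I)
        (((phi n x - u x) ^+ 2
          + omega x * ((derive1 (phi n)) x - du x) ^+ 2)%:E))%E
       @ \oo --> 0%E).

Definition aform (du dv : R -> R) : R := intI (fun x => omega x * du x * dv x).
Definition pairing (f v : R -> R) : R := intI (fun x => f x * v x).

Definition normV (du : R -> R) : R := Num.sqrt (intI (fun x => omega x * du x ^+ 2)).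
Definition normL2 (u : R -> R) : R := Num.sqrt (intI (fun x => u x ^+ 2)).

Definition weak_deriv (g u : R -> R) : Prop :=
  forall phi, test_fun phi ->
    intI (fun x => u x * derive1 phi x) = - intI (fun x => g x * phi x).

Definition in_Hm (m : nat) (u : R -> R) (D : nat -> R -> R) : Prop :=
  D 0%N = u /\ (forall k, (k <= m)%N -> L2 (D k)) /\
  (forall k, (k < m)%N -> weak_deriv (D k.+1) (D k)).

Definition normHm (m : nat) (D : nat -> R -> R) : R :=
  Num.sqrt (\sum_(k < m.+1) intI (fun x => D k x ^+ 2)).

Fixpoint cheb_pair (k : nat) : {poly R} * {poly R} :=
  match k with
  | 0%N => (1, 'X)
  | k'.+1 => let: (a, b) := cheb_pair k' in (b, 2%:P * 'X * b - a)
  end.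
Definition chebT (k : nat) : {poly R} := (cheb_pair k).1.

Definition chebphi (n : nat) : {poly R} := chebT n.+2 - chebT n.

Definition in_VN (N : nat) (p : {poly R}) : Prop :=
  exists c : nat -> R, p = \sum_(n < N.-1) c n *: chebphi n.

End Defs.

(* Main.v *)
(* The second-kind Chebyshev polynomials U_k are orthogonal for the weight omega,
   and (omega Q_k)' = omega U_k with Q_k = (U_{k+1}/(k+2) - U_{k-1}/k) / 2.  Since
   omega Q_k vanishes at the end points, integrating by parts against weak
   derivatives expresses the U-coefficients of u^(j) through those of u^(j+1) with a
   gain of a factor 1/k; with Bessel's inequality for u^(m) this makes the tail
   sum_{k >= N} a_k^2 of the coefficients a_k of u' of size N^{-2(m-1)}.

   Split u' into z', the sum over k < N, and a tail t', with z(-1) = t(-1) = 0.  The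
   tail obeys both bounds: t is a combination of T_{k+1}/(k+1), whose L^2 Gram matrix
   is bounded by Schur's test, and its value at 1 is O(N^{-m}) because the recursion
   makes that sum telescope up to terms of order k^{-3}; a plain Cauchy-Schwarz bound
   would lose N^{1/2}.  The remainder z - u_N is a-orthogonal to V_N, hence controlled
   by its value at 1, which is -t(1).  This replaces the duality argument for the L^2
   estimate. *)
Require Import Defs.
From mathcomp Require Import all_boot all_order all_algebra.
From mathcomp Require Import all_classical all_reals all_analysis.
From mathcomp Require Import measurable_realfun ring lra zify.
Import Order.TTheory GRing.Theory Num.Theory numFieldNormedType.Exports.
Local Open Scope ring_scope.

(** The data are known only weakly: [D k] through integrals against test functions, [du] as a limit
    of derivatives of test functions, and nothing states that [du] agrees with [D 1]. Neither may be
    paired with [omega Q_k] directly. So identities pass from test functions to polynomials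
    vanishing at the end points (smooth cut-offs), and from those to functions such as [omega Q_k]
    (Weierstrass approximation with control of the derivative). [du] and [D 1] are compared only
    through their [omega]-moments against polynomials, which is all that the coefficients see. The
    same approximations put V_N inside V and make the expansion converge.

    The end point 1 is the obstacle: the truncated primitive z vanishes at -1 but in general not at
    1, hence need not lie in V_N. The condition u(1) = 0 enters as the convergence to 0 of the
    values at 1 of the partial primitives, so that -t(1) is the defect of z. Its rate N^{-m} comes
    from the coefficients of u'', which are O(N^{-(m-2)}), and two further powers of N won by
    telescoping; this is where m >= 2 enters. *)

(** * Algebra of the Chebyshev polynomials of both kinds *)

Section Chebyshev.
Variable R : realType.
Implicit Types (m n k : nat) (x : R).

(* The pair (T_n, U_{n-1}); the index shift makes every recursion one-step. *)
Fixpoint chebTS (n : nat) : {poly R} * {poly R} :=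
  if n is n'.+1 then
    let: (t, s) := chebTS n' in ('X * t - (1 - 'X^2) * s, 'X * s + t)
  else (1, 0).

Definition chT n := (chebTS n).1.
Definition chS n := (chebTS n).2.

Lemma chT0 : chT 0 = 1. Proof. by []. Qed.
Lemma chS0 : chS 0 = 0. Proof. by []. Qed.
Lemma chTS n : chT n.+1 = 'X * chT n - (1 - 'X^2) * chS n.
Proof. by rewrite /chT /chS /=; case: (chebTS n). Qed.
Lemma chSS n : chS n.+1 = 'X * chS n + chT n.
Proof. by rewrite /chT /chS /=; case: (chebTS n). Qed.

Lemma chS1 : chS 1 = 1. Proof. by rewrite chSS chS0 chT0 mulr0 add0r. Qed.
Lemma chT1 : chT 1 = 'X. Proof. by rewrite chTS chS0 chT0 mulr0 subr0 mulr1. Qed.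

Lemma chTSS n : chT n.+2 = 2%:P * 'X * chT n.+1 - chT n.
Proof. rewrite !chTS chSS; ring. Qed.

Lemma chSSS n : chS n.+2 = 2%:P * 'X * chS n.+1 - chS n.
Proof. rewrite !chSS chTS; ring. Qed.

Lemma cheb_pairE n : cheb_pair R n = (chT n, chT n.+1).
Proof.
elim: n => [|n IH]; first by rewrite /= chT1.
by rewrite [cheb_pair R _]/= IH chTSS.
Qed.

Lemma chebTE n : chebT R n = chT n.
Proof. by rewrite /chebT cheb_pairE. Qed.

(** With x = cos t, [chT n] is cos(nt) and [chS n] is sin(nt)/sin t, so this is cos^2 + sin^2 = 1;
    the factor [1 - 'X^2] keeps it polynomial. *)
Lemma cheb_pell n : chT n ^+ 2 + (1 - 'X^2) * chS n ^+ 2 = 1.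
Proof.
elim: n => [|n IH]; first by rewrite chT0 chS0; ring.
rewrite -[RHS]IH chTS chSS; ring.
Qed.

Lemma chTD m n : chT (m + n) = chT m * chT n - (1 - 'X^2) * chS m * chS n
  /\ chS (m + n) = chS m * chT n + chT m * chS n.
Proof.
elim: m => [|m [IHT IHS]]; first by rewrite chT0 chS0 add0n; split; ring.
by rewrite addSn (chTS (m + n)) (chSS (m + n)) (chTS m) (chSS m) IHT IHS; split; ring.
Qed.

Lemma chTDE m n : chT (m + n) = chT m * chT n - (1 - 'X^2) * chS m * chS n.
Proof. by have [] := chTD m n. Qed.

Lemma chSDE m n : chS (m + n) = chS m * chT n + chT m * chS n.
Proof. by have [] := chTD m n. Qed.

(** This is 2 cos a cos b = cos(a + b) + cos(a - b), with the larger index written [m + n] to avoid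
    subtraction. It reduces the unweighted Gram matrix of the T_k to integrals of single T_k. *)
Lemma chT_mul m n : chT (m + n) * chT n *+ 2 = chT (m + n + n) + chT m.
Proof.
have h := cheb_pell n.
have -> : chT m = chT m * (chT n ^+ 2 + (1 - 'X^2) * chS n ^+ 2) by rewrite h mulr1.
rewrite (chTDE (m + n)) (chTDE m) (chSDE m); ring.
Qed.

(** One step of the linearisation of a product: a single [chS] splits off and both indices drop by
    one, which turns orthogonality into an induction. *)
Lemma chS_mulSS m n : chS m.+1 * chS n.+1 = chS (m + n).+1 + chS m * chS n.
Proof. by rewrite -addnS chSDE !chSS chTS; ring. Qed.

(** Each derivative involves both families, hence the joint induction; the factor [1 - 'X^2] clears
    the denominator of the derivative of sin(nt)/sin t. *)
Lemma cheb_deriv n : (chT n)^`() = n%:R%:P * chS n /\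
  (1 - 'X^2) * (chS n)^`() = 'X * chS n - n%:R%:P * chT n.
Proof.
elim: n => [|n [IHT IHS]].
  by rewrite chT0 chS0 poly.derivE deriv0 !mul0r !mulr0 subr0.
have e : n.+1%:R%:P = n%:R%:P + 1 :> {poly R} by rewrite -natr1 polyCD.
have d2 : (1 - 'X^2 : {poly R})^`() = - ('X + 'X) by rewrite !poly.derivE /= expr1 sub0r mulr2n.
rewrite chTS chSS !derivD derivN !derivM derivX d2 IHT e; split.
  transitivity (chT n + 'X * (n%:R%:P * chS n) + ('X + 'X) * chS n - (1 - 'X^2) * (chS n)^`()).
    ring.
  rewrite IHS; ring.
transitivity ((1 - 'X^2) * chS n + 'X * ((1 - 'X^2) * (chS n)^`()) + (1 - 'X^2) * (n%:R%:P * chS n)).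
  ring.
rewrite IHS; ring.
Qed.

Lemma deriv_chT n : (chT n)^`() = n%:R%:P * chS n.
Proof. by have [] := cheb_deriv n. Qed.

Lemma deriv_chS n : (1 - 'X^2) * (chS n)^`() = 'X * chS n - n%:R%:P * chT n.
Proof. by have [] := cheb_deriv n. Qed.

(** Serves twice: it exhibits [chebphi] as a multiple of (1 - x^2) U_n, and it closes the
    antiderivative identity [chQ_eq]. *)
Lemma chTB n : chT n - chT n.+2 = 2%:P * (1 - 'X^2) * chS n.+1.
Proof. rewrite !chTS !chSS; ring. Qed.

Lemma chT_chS n : chT n.+1 *+ 2 = chS n.+2 - chS n.
Proof. by rewrite !chSS chTS; ring. Qed.

Lemma horner_chT1 n : (chT n).[1] = 1.
Proof. by elim: n => [|n IH]; rewrite ?chT0 ?chTS !hornerE //= IH; ring. Qed.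

Lemma horner_chTN1 n : (chT n).[-1] = (-1) ^+ n.
Proof.
elim: n => [|n IH]; rewrite ?chT0 ?chTS !hornerE //= IH.
by rewrite [in RHS]exprS expr2 mulrNN mulr1 subrr mul0r subr0.
Qed.

Lemma chT_le1 n x : -1 <= x -> x <= 1 -> `|(chT n).[x]| <= 1.
Proof.
move=> x1 x2; rewrite -(@expr_le1 _ 2) // real_normK ?num_real //.
have := congr1 (horner^~ x) (cheb_pell n).
rewrite !(hornerD, hornerN, hornerM, horner_exp, hornerX, hornerC) => <-.
rewrite lerDl; apply: mulr_ge0; last exact: sqr_ge0.
have -> : 1 - x ^+ 2 = (1 - x) * (1 + x) by ring.
by apply: mulr_ge0; lra.
Qed.

Lemma size_cheb n : [/\ (size (chT n) <= n.+1)%N, size (chS n.+1) = n.+1 & 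
  lead_coef (chS n.+1) = 2 ^+ n].
Proof.
have X2 k (p : {poly R}) : size p = k.+1 -> size (2%:P * 'X * p) = k.+2 /\
   lead_coef (2%:P * 'X * p) = 2 * lead_coef p.
  move=> sp; have p0 : p != 0 by rewrite -size_poly_gt0 sp.
  have n2 : (2 : R) != 0 by rewrite pnatr_eq0.
  rewrite -mulrA -['X * p]mulrC mul_polyC size_scale // size_mulX // sp.
  by rewrite lead_coefZ lead_coefMX.
have hS k : size (chS k.+1) = k.+1 /\ lead_coef (chS k.+1) = 2 ^+ k /\
   size (chS k.+2) = k.+2 /\ lead_coef (chS k.+2) = 2 ^+ k.+1.
  elim: k => [|k [s0 [_ [s1 l1]]]].
    rewrite chS1 size_poly1 lead_coef1 expr0 chSSS chS1 chS0 subr0.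
    have [] := X2 0%N 1; first by rewrite size_poly1.
    by move=> -> ->; rewrite lead_coef1 mulr1 expr1.
  do 2!split => //; rewrite chSSS.
  have [sz lc] := X2 _ _ s1.
  have szB : (size (- chS k.+1) < size (2%:P * 'X * chS k.+2)%R)%N by rewrite size_polyN sz s0.
  by rewrite size_polyDl // lead_coefDl // sz lc l1 -exprS.
split; [|by case: (hS n)|by case: (hS n) => _ []].
case: n => [|n]; first by rewrite chT0 size_poly1.
have -> : chT n.+1 = 2^-1 *: (chT n.+1 *+ 2).
  by rewrite -(scaler_nat 2 (chT n.+1)) scalerA mulVf ?scale1r // pnatr_eq0.
rewrite chT_chS; apply: (leq_trans (size_scale_leq _ _)).
apply: (leq_trans (size_polyD _ _)); rewrite geq_max size_polyN.
have [_ [_ [-> _]]] := hS n; rewrite leqnn /=.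
case: n => [|n]; first by rewrite chS0 size_poly0.
have [-> _] := hS n; lia.
Qed.

Lemma size_chT n : (size (chT n) <= n.+1)%N. Proof. by have [] := size_cheb n. Qed.
Lemma size_chS n : size (chS n.+1) = n.+1. Proof. by have [] := size_cheb n. Qed.

Lemma chS_span n (p : {poly R}) : (size p <= n)%N ->
  exists c : nat -> R, p = \sum_(k < n) c k *: chS k.+1.
Proof.
elim: n p => [p|n IH p sp].
  by rewrite leqn0 size_poly_eq0 => /eqP ->; exists (fun _ => 0); rewrite big_ord0.
have [_ sS lS] := size_cheb n.
pose a := p`_n / 2 ^+ n.
have n2 : (2 ^+ n : R) != 0 by rewrite expf_neq0 // pnatr_eq0.
have [|c hc] := IH (p - a *: chS n.+1).
  apply/leq_sizeP => j; rewrite leq_eqVlt => /orP[/eqP <-|nj].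
    rewrite coefB coefZ; move: lS; rewrite lead_coefE sS /= => ->.
    by rewrite /a divfK // subrr.
  rewrite coefB coefZ !nth_default ?mulr0 ?subr0 ?sS //.
  exact: leq_trans sp nj.
exists (fun k => if k == n then a else c k).
rewrite big_ord_recr /= eqxx -[LHS](subrK (a *: chS n.+1)) hc; congr (_ + _).
by apply: eq_bigr => i _; rewrite (ltn_eqF (ltn_ord i)).
Qed.

End Chebyshev.

(** * Weierstrass approximation by Bernstein polynomials on [-1,1] *)

Section Weierstrass.
Variable R : realType.
Implicit Types (f g : nat -> R) (x : R).

(* Expectation of [f] after [n] steps of the walk that moves up with
   probability [(1 + X) / 2]: the Bernstein operator of the interval [-1,1]. *)
Fixpoint bern n f : {poly R} :=
  if n is n'.+1 then
    (2^-1)%:P * (1 - 'X) * bern n' f + (2^-1)%:P * (1 + 'X) * bern n' (fun k => f k.+1)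
  else (f 0%N)%:P.

Lemma bernSE n f x : (bern n.+1 f).[x] =
  2^-1 * (1 - x) * (bern n f).[x] + 2^-1 * (1 + x) * (bern n (fun k => f k.+1)).[x].
Proof. by rewrite /= !(hornerD, hornerN, hornerM, hornerX, hornerC). Qed.

Lemma bern_le n f g x : -1 <= x -> x <= 1 ->
  (forall k, (k <= n)%N -> f k <= g k) -> (bern n f).[x] <= (bern n g).[x].
Proof.
move=> x1 x2; elim: n f g => [|n IH] f g fg; first by rewrite !hornerC fg.
rewrite !bernSE; apply: lerD; (apply: ler_wpM2l; first by lra); apply: IH => k kn; apply: fg; lia.
Qed.

Lemma bernC n c x : (bern n (fun=> c)).[x] = c.
Proof. elim: n => [|n IH]; [by rewrite hornerC | by rewrite bernSE IH; field]. Qed.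

Lemma bernD n f g a b x : (bern n (fun k => a * f k + b * g k)).[x] =
  a * (bern n f).[x] + b * (bern n g).[x].
Proof.
elim: n f g => [|n IH] f g; first by rewrite !hornerC.
by rewrite !bernSE !IH; ring.
Qed.

(** The free shift [d] carries the induction, since an upward step turns it into [d + 2]. At d =
    -n(1 + x) the square vanishes and the variance n(1 - x^2) remains. *)
Lemma bern_moment n d x : (bern n (fun k => (2 * k%:R + d) ^+ 2)).[x] =
  (n%:R * (1 + x) + d) ^+ 2 + n%:R * (1 - x ^+ 2).
Proof.
elim: n d => [|n IH] d; first by rewrite hornerC; ring.
rewrite bernSE IH.
have -> : (fun k => (2 * k.+1%:R + d) ^+ 2) = (fun k => (2 * k%:R + (d + 2)) ^+ 2) :> (nat -> R).
  by apply/funext => k; rewrite -natr1; ring.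
by rewrite IH -natr1; field.
Qed.

(* Uniform continuity, in the form that the second moment of the walk controls. *)
Definition Wc (f : R -> R) := forall e : R, 0 < e -> exists2 C : R, 0 <= C &
  forall x y : R, -1 <= x -> x <= 1 -> -1 <= y -> y <= 1 -> `|f x - f y| <= e + C * (x - y) ^+ 2.

Lemma weierstrass (f : R -> R) : Wc f -> forall e : R, 0 < e ->
  exists P : {poly R}, forall x, -1 <= x -> x <= 1 -> `|P.[x] - f x| <= e.
Proof.
move=> fW e e0; have [|C C0 fC] := fW (e / 2); first by lra.
(* Under the walk, the second moment of [y k - x] is (1 - x^2)/n, so n > 2C/e makes its contribution
   C(1 - x^2)/n at most e/2. *)
pose n := (Num.truncn (2 * C / e)).+1.
have n0 : 0 < n%:R :> R by rewrite ltr0n.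
have nC : C / n%:R <= e / 2.
  have : 2 * C / e < n%:R by apply: Num.Theory.truncnS_gt.
  rewrite ltr_pdivrMr // ler_pdivrMr // => h; nra.
pose y (k : nat) : R := 2 * k%:R / n%:R - 1.
exists (bern n (f \o y)) => x x1 x2.
have dev k : (k <= n)%N -> `|f (y k) - f x| <= e / 2 + C * (y k - x) ^+ 2.
  move=> kn; have k0 : (0 : R) <= k%:R := ler0n _ _.
  have kn' : (k%:R : R) <= n%:R by rewrite ler_nat.
  apply: fC => //; rewrite /y.
    by rewrite lerBrDr addrC subrr divr_ge0 // mulr_ge0 //; lra.
  rewrite lerBlDr ler_pdivrMr //; lra.
have sq k : e / 2 + C * (y k - x) ^+ 2 =
    e / 2 * 1 + (C / n%:R ^+ 2) * (2 * k%:R + (- n%:R * (1 + x))) ^+ 2.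
  rewrite /y; field; lra.
have bnd : (bern n (fun k => e / 2 * 1 + (C / n%:R ^+ 2) * (2 * k%:R + (- n%:R * (1 + x))) ^+ 2)).[x]
   <= e.
  rewrite (bernD _ (fun=> 1)) bernC bern_moment.
  have -> : e / 2 * 1 + C / n%:R ^+ 2 * ((n%:R * (1 + x) + - n%:R * (1 + x)) ^+ 2 + n%:R * (1 - x ^+ 2)) =
     e / 2 + C / n%:R * (1 - x ^+ 2) by field; lra.
  have Cn : 0 <= C / n%:R by rewrite divr_ge0 // ltW.
  nra.
rewrite ler_norml; apply/andP; split.
  rewrite lerBrDr addrC; apply: le_trans (_ : (bern n (fun k => 1 * f x + (-1) *
     (e / 2 * 1 + (C / n%:R ^+ 2) * (2 * k%:R + (- n%:R * (1 + x))) ^+ 2))).[x] <= _).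
    rewrite (bernD _ (fun=> f x)) bernC; lra.
  apply: bern_le => // k /dev; rewrite sq ler_norml /= => /andP[h1 h2]; lra.
rewrite lerBlDr; apply: (@le_trans _ _ (bern n (fun k => 1 * f x + 1 *
     (e / 2 * 1 + (C / n%:R ^+ 2) * (2 * k%:R + (- n%:R * (1 + x))) ^+ 2))).[x]).
  apply: bern_le => // k /dev; rewrite sq ler_norml /= => /andP[h1 h2]; lra.
rewrite (bernD _ (fun=> f x)) bernC; lra.
Qed.

Lemma WcM (f g : R -> R) : Wc f -> Wc g -> Wc (fun x => f x * g x).
Proof.
have bd (h : R -> R) : Wc h -> exists2 B : R, 1 <= B & forall x : R, -1 <= x -> x <= 1 -> `|h x| <= B.
  move=> /(_ 1 ltr01) [C C0 hC]; exists (`|h 0| + 1 + C).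
    by have := normr_ge0 (h 0); lra.
  move=> x x1 x2; have h1 : `|h x - h 0| <= 1 + C * (x - 0) ^+ 2 by apply: hC => //; lra.
  rewrite subr0 in h1.
  have := ler_normD (h x - h 0) (h 0); rewrite subrK => h2.
  have : x ^+ 2 <= 1 by nra.
  nra.
move=> fW gW e e0.
have [A A1 fA] := bd _ fW; have [B B1 gB] := bd _ gW.
have [|C C0 fC] := fW (e / (2 * B)); first by rewrite divr_gt0 //; lra.
have [|D D0 gD] := gW (e / (2 * A)); first by rewrite divr_gt0 //; lra.
exists (B * C + A * D); first by rewrite addr_ge0 // mulr_ge0 //; lra.
move=> x y x1 x2 y1 y2.
have -> : f x * g x - f y * g y = (f x - f y) * g x + f y * (g x - g y) by ring.
apply: (le_trans (ler_normD _ _)); rewrite !normrM.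
have h1 := fC _ _ x1 x2 y1 y2; have h2 := gD _ _ x1 x2 y1 y2.
have -> : e + (B * C + A * D) * (x - y) ^+ 2 =
   (e / (2 * B) + C * (x - y) ^+ 2) * B + A * (e / (2 * A) + D * (x - y) ^+ 2).
  by field; lra.
apply: lerD; (apply: ler_pM; [exact: normr_ge0|exact: normr_ge0| |]).
- exact: h1.
- exact: gB.
- exact: fA.
- exact: h2.
Qed.

(** Young's inequality: L d <= e + L^2 d^2 / e. *)
Lemma Wc_lip (f : R -> R) (L : R) : 0 <= L -> (forall x y : R, -1 <= x -> x <= 1 -> -1 <= y -> y <= 1 ->
  `|f x - f y| <= L * `|x - y|) -> Wc f.
Proof.
move=> L0 fL e e0; exists (L ^+ 2 / e); first by rewrite divr_ge0 ?sqr_ge0 // ltW.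
move=> x y x1 x2 y1 y2; apply: (le_trans (fL _ _ x1 x2 y1 y2)).
rewrite -[(x - y) ^+ 2]real_normK ?num_real //; set d := `|x - y|.
have -> : e + L ^+ 2 / e * d ^+ 2 = (e ^+ 2 + L ^+ 2 * d ^+ 2) / e by field; lra.
rewrite ler_pdivlMr //; have := sqr_ge0 (e - L * d); nra.
Qed.

Lemma Wc_deriv (f df : R -> R) (B : R) : (forall x, is_derive x 1 f (df x)) -> 0 <= B ->
  (forall x, -1 <= x -> x <= 1 -> `|df x| <= B) -> Wc f.
Proof.
move=> fd B0 dB; apply: (@Wc_lip _ B) => //.
have cf : continuous f.
  by move=> x; apply/differentiable_continuous/derivable1_diffP; have [] := fd x.
have main (x y : R) : x <= y -> -1 <= x -> y <= 1 -> `|f y - f x| <= B * `|y - x|.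
  move=> xy x1 y1; have [|c cxy ->] := @MVT_segment _ f df x y xy.

  - by apply: continuous_subspaceT.
  rewrite normrM; apply: ler_wpM2r => //; apply: dB; move: cxy; rewrite in_itv /= => /andP[]; lra.
move=> x y x1 x2 y1 y2; have [xy|/ltW yx] := leP x y; last exact: main.
by rewrite distrC (distrC x); apply: main.
Qed.

Lemma Wc_poly (p : {poly R}) : Wc (horner p).
Proof.
have [||c _ hc] := @EVT_max R (fun x => `|p^`().[x]|) (-1) 1.
  by lra.
  apply: continuous_subspaceT => x; apply: continuous_comp; last exact: norm_continuous.
  exact: continuous_horner.
apply: (@Wc_deriv _ (horner p^`()) `|p^`().[c]|) => // x x1 x2.
by apply: hc; rewrite in_itv /= x1 x2.
Qed.

(** Rests on |a - b|^2 <= |a^2 - b^2| for nonnegative a and b. This is how [omega], which is not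
    Lipschitz at the end points, is covered. *)
Lemma Wc_sqrt (f : R -> R) : (forall x, -1 <= x -> x <= 1 -> 0 <= f x) -> Wc f ->
  Wc (fun x => Num.sqrt (f x)).
Proof.
move=> f0 fW e e0.
have [|C C0 fC] := fW (e ^+ 2); first by rewrite exprn_gt0.
exists (C / e); first by rewrite divr_ge0 // ltW.
move=> x y x1 x2 y1 y2; set a := Num.sqrt _; set b := Num.sqrt _.
have a2 : a ^+ 2 = f x by rewrite sqr_sqrtr // f0.
have b2 : b ^+ 2 = f y by rewrite sqr_sqrtr // f0.
have a0 : 0 <= a by rewrite sqrtr_ge0.
have b0 : 0 <= b by rewrite sqrtr_ge0.
have d2 : `|a - b| ^+ 2 <= e ^+ 2 + C * (x - y) ^+ 2.
  apply: le_trans (fC _ _ x1 x2 y1 y2); rewrite -a2 -b2.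
  have -> : a ^+ 2 - b ^+ 2 = (a - b) * (a + b) by ring.
  rewrite normrM expr2; apply: ler_wpM2l => //.
  by rewrite (ger0_norm (addr_ge0 a0 b0)) ler_norml; apply/andP; split; lra.
have -> : e + C / e * (x - y) ^+ 2 = (e ^+ 2 + C * (x - y) ^+ 2) / e by field; lra.
rewrite ler_pdivlMr //; have := normr_ge0 (a - b); set d := `|a - b| in d2 *.
have := sqr_ge0 (x - y); set q := (x - y) ^+ 2 in d2 *.
move=> q0 d0; have := mulr_ge0 C0 q0; have [] := leP d e; nra.
Qed.

End Weierstrass.

(** * Polynomial approximation together with the derivative, and calculus of [omega] *)

Section PolynomialApproximation.
Local Open Scope classical_set_scope.
Local Open Scope ring_scope.
Variable R : realType.
Implicit Types (x e : R) (p q : {poly R}).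

Lemma poly_primitive p : exists2 q, q^`() = p & q.[-1] = 0.
Proof.
have [c ->] := @chS_span R (size p) p (leqnn _).
pose q := \sum_(k < size p) (c k / k.+1%:R) *: chT R k.+1.
exists (q - q.[-1]%:P); last by rewrite hornerD hornerN hornerC subrr.
rewrite derivB derivC subr0 raddf_sum; apply: eq_bigr => k _.
rewrite [LHS]/= derivZ.
by rewrite deriv_chT mul_polyC scalerA divfK // pnatr_eq0.
Qed.

(** The derivative is approximated and then integrated: closeness of functions would say nothing
    about derivatives. Differentiability is asked only inside, because the product rule for [omega]
    breaks down at the end points. *)
Lemma poly_approx_derivable (F f : R -> R) :
  (forall x, -1 < x -> x < 1 -> is_derive x 1 F (f x)) ->
  {within `[-1, 1], continuous F} -> F (-1) = 0 -> F 1 = 0 -> Wc R f ->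
  forall e : R, 0 < e -> exists P : {poly R}, [/\ P.[-1] = 0, P.[1] = 0 &
    forall x, -1 <= x -> x <= 1 -> `|P.[x] - F x| <= e /\ `|P^`().[x] - f x| <= e].
Proof.
move=> Fd Fc Fm F1 fW e e0.
have [|r rf] := @weierstrass R f fW (e / 4); first by lra.
have [q qr q0] := poly_primitive r.
have dif x : -1 <= x -> x <= 1 -> `|q.[x] - F x| <= e / 2.
  move=> x1 x2.
  have [| |c cx] := @MVT_segment R (fun t => q.[t] - F t) (fun t => r.[t] - f t) (-1) x x1.
  - move=> t; rewrite in_itv /= => /andP[t1 t2].
    have Ft : is_derive t 1 F (f t) by apply: Fd => //; lra.
    have qt : is_derive t 1 (horner q) r.[t] by rewrite -qr; exact: is_derive_poly.
    exact: (@is_deriveB _ _ _ _ _ t 1 r.[t] (f t) qt Ft).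
  - have sub : (`[-1, x] `<=` `[-1, 1])%classic by move=> t /=; rewrite !in_itv /= => /andP[-> /= h]; lra.
    move=> t; apply: cvgB; first by apply: continuous_subspaceT => y; exact: continuous_horner.
    exact: (continuous_subspaceW sub Fc).
  rewrite q0 Fm subrr subr0 => ->; rewrite normrM.
  move: cx; rewrite in_itv /= => /andP[c1 c2].
  have := rf c c1 (le_trans c2 x2) => h.
  have -> : `|x - -1| = x + 1 by rewrite ger0_norm; lra.
  nra.
have q1 : `|q.[1]| <= e / 2 by have := dif 1 _ (lexx _); rewrite F1 subr0; apply; lra.
(* The linear term vanishes at -1 and cancels [q.[1]]. As |q(1)| <= e/2, it costs at most e/2 in
   value and e/4 in slope. *)
exists (q - (q.[1] / 2) *: ('X + 1)); split.
- by rewrite !(hornerD, hornerN, hornerZ, hornerX, hornerC) q0; ring.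
- by rewrite !(hornerD, hornerN, hornerZ, hornerX, hornerC); field.
move=> x x1 x2; rewrite derivB derivZ derivD derivX -polyC1 derivC addr0.
rewrite !(hornerD, hornerN, hornerZ, hornerX, hornerC) mulr1 qr.
have h1 := dif x x1 x2; have h2 := rf x x1 x2.
move: q1 h1 h2; rewrite !ler_norml => /andP[a1 a2] /andP[b1 b2] /andP[c1 c2].
by split; apply/andP; split; nra.
Qed.

Lemma omega_ge0 x : 0 <= omega x. Proof. exact: sqrtr_ge0. Qed.

Lemma omega_sqr x : -1 <= x -> x <= 1 -> omega x ^+ 2 = 1 - x ^+ 2.
Proof. by move=> x1 x2; rewrite /omega sqr_sqrtr //; nra. Qed.

Lemma omega_le1 x : omega x <= 1.
Proof.
have := @sqr_ge0 R x => h; rewrite -[leRHS]sqrtr1 ler_wsqrtr //; lra.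
Qed.

Lemma omega_gt0 x : -1 < x -> x < 1 -> 0 < omega x.
Proof. by move=> x1 x2; rewrite sqrtr_gt0; nra. Qed.

Lemma omega1 : omega (1 : R) = 0. Proof. by rewrite /omega expr1n subrr sqrtr0. Qed.
Lemma omegaN1 : omega (-1 : R) = 0. Proof. by rewrite /omega sqrrN expr1n subrr sqrtr0. Qed.

Lemma omega_continuous : continuous (@omega R).
Proof.
move=> x; apply: (@continuous_comp _ _ _ (fun x : R => 1 - x ^+ 2) Num.sqrt).
  have -> : (fun x : R => 1 - x ^+ 2) = horner (1 - 'X^2 : {poly R}).
    by apply/funext => y; rewrite !(hornerD, hornerN, horner_exp, hornerX, hornerC).
  exact: continuous_horner.
exact: sqrt_continuous.
Qed.

Lemma omega_derive x : -1 < x -> x < 1 -> is_derive x 1 (@omega R) (- x / omega x).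
Proof.
move=> x1 x2; have w0 := omega_gt0 x x1 x2.
have pos : 0 < 1 - x ^+ 2 by nra.
pose g := horner (1 - 'X^2 : {poly R}).
have gE : (fun x : R => 1 - x ^+ 2) = g.
  by apply/funext => y; rewrite /g !(hornerD, hornerN, horner_exp, hornerX, hornerC).
have gd : is_derive x 1 g (- (x *+ 2)).
  apply: is_derive_eq (is_derive_poly _ _) _.
  by rewrite !poly.derivE /= !(hornerD, hornerN, hornerM, hornerX, hornerC); ring.
have sd : is_derive (g x) 1 (Num.sqrt : R -> R) (2 * Num.sqrt (g x))^-1.
  by apply: is_derive1_sqrt; rewrite -gE.
have -> : @omega R = Num.sqrt \o g by rewrite -gE.
apply: is_derive_eq (is_derive1_comp _ _) _.
rewrite -gE /= -!/(omega x); field; lra.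
Qed.

Lemma Wc_omega : Wc R (@omega R).
Proof.
apply: Wc_sqrt; first by move=> x x1 x2; nra.
have -> : (fun x : R => 1 - x ^+ 2) = horner (1 - 'X^2 : {poly R}).
  by apply/funext => y; rewrite !(hornerD, hornerN, horner_exp, hornerX, hornerC).
exact: Wc_poly.
Qed.

(** Multiplying (omega q)' = omega p by [omega] removes the square roots and leaves the polynomial
    identity taken as hypothesis. *)
Lemma omega_mul_derive p q : (1 - 'X^2) * q^`() - 'X * q = (1 - 'X^2) * p ->
  forall x, -1 < x -> x < 1 ->
  is_derive x 1 (fun x => omega x * q.[x]) (omega x * p.[x]).
Proof.
move=> pq x x1 x2.
have dw := omega_derive x x1 x2; have dq := @is_derive_poly R q x.
have w0 := omega_gt0 x x1 x2.
have pos : 1 - x ^+ 2 != 0 by rewrite gt_eqF //; nra.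
apply: is_derive_eq (@is_deriveM _ _ _ _ _ _ _ _ dw dq) _.
have := congr1 (horner^~ x) pq.
rewrite !(hornerD, hornerN, hornerM, horner_exp, hornerX, hornerC) => h.
apply: (mulfI pos); rewrite mulrCA -h /GRing.scale /=.
rewrite -!expr2 -(omega_sqr x (ltW x1) (ltW x2)); field; by rewrite (gt_eqF w0).
Qed.

(** The polynomial Q_{k+1} of the overview. The shift leaves out U_0: the integral of [omega] over I
    is positive, so [omega] has no antiderivative that vanishes at both ends. *)
Definition chQ k : {poly R} :=
  2^-1 *: (k.+3%:R^-1 *: chS R k.+3 - k.+1%:R^-1 *: chS R k.+1).

Lemma chQ_eq k : (1 - 'X^2) * (chQ k)^`() - 'X * chQ k = (1 - 'X^2) * chS R k.+2.
Proof.
have one n : (1 - 'X^2) * (n.+1%:R^-1 *: chS R n.+1)^`() - 'X * (n.+1%:R^-1 *: chS R n.+1)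
     = - chT R n.+1.
  rewrite derivZ -!scalerAr deriv_chS -scalerBr addrAC subrr sub0r mul_polyC.
  by rewrite scalerN scalerA mulVf ?scale1r // pnatr_eq0.
rewrite /chQ derivZ derivB.
transitivity (2^-1 *: (- chT R k.+3 + chT R k.+1)).
  rewrite -(one k.+2) -[chT R k.+1]opprK -(one k) -!(scalerAr 2^-1) -scalerBr; congr (_ *: _); ring.
by rewrite addrC chTB -mulrA mul_polyC scalerA mulVf ?scale1r // pnatr_eq0.
Qed.

End PolynomialApproximation.

(** * Smooth cut-offs: polynomials vanishing at the ends as limits of test functions *)

Section SmoothCutoff.
Variable R : realType.
Local Open Scope classical_set_scope.
Local Open Scope ring_scope.
Implicit Types (f g : R -> R) (x y : R) (p : {poly R}).

Fixpoint Ck (n : nat) f : Prop :=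
  if n is n'.+1 then (forall x, derivable f x 1) /\ Ck n' (derive1 f) else True.

Lemma CkW n f : Ck n.+1 f -> Ck n f.
Proof. by elim: n f => [//|n IH] f [df dn]; split => //; exact: IH. Qed.

Lemma Ck_derive1n f : (forall n, Ck n f) -> forall n x, derivable (derive1n n f) x 1.
Proof.
move=> fC n; elim: n f fC => [|n IH] f fC x; first by have [] := fC 1%N.
by rewrite derive1Sn; apply: IH => k; have [] := fC k.+1.
Qed.

Lemma derive1_is f df : (forall x, is_derive x 1 f (df x)) ->
  (forall x, derivable f x 1) /\ derive1 f = df.
Proof.
move=> h; split=> [x|]; first exact: ex_derive.
by apply/funext => x; rewrite derive1E; exact: derive_val.
Qed.

Lemma CkD n f g : Ck n f -> Ck n g -> Ck n (f + g).
Proof.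
elim: n f g => [//|n IH] f g [df cf] [dg cg].
have [|d e] := @derive1_is (f + g) (derive1 f + derive1 g).
  move=> x; rewrite [X in is_derive _ _ _ X](_ : _ = derive1 f x + derive1 g x) // !derive1E.
  by apply: is_deriveD; apply: derivableP.
by split => //; rewrite e; exact: IH.
Qed.

Lemma CkM n f g : Ck n f -> Ck n g -> Ck n (f * g).
Proof.
elim: n f g => [//|n IH] f g fC gC; have [df cf] := fC; have [dg cg] := gC.
have [|d e] := @derive1_is (f * g) (f * derive1 g + g * derive1 f).
  move=> x; rewrite [X in is_derive _ _ _ X](_ : _ = f x *: derive1 g x + g x *: derive1 f x) // !derive1E.
  by apply: is_deriveM; apply: derivableP.
by split => //; rewrite e; apply: CkD; apply: IH => //; exact: CkW.
Qed.

Lemma Ck_comp n f g : Ck n f -> Ck n g -> Ck n (f \o g).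
Proof.
elim: n f g => [//|n IH] f g fC gC; have [df cf] := fC; have [dg cg] := gC.
have [|d e] := @derive1_is (f \o g) ((derive1 f \o g) * derive1 g).
  move=> x; rewrite [X in is_derive _ _ _ X](_ : _ = derive1 f (g x) * derive1 g x) // !derive1E.
  by apply: is_derive1_comp; apply: derivableP.
by split => //; rewrite e; apply: CkM => //; apply: IH => //; exact: CkW.
Qed.

Lemma Ck_poly n p : Ck n (horner p).
Proof.
elim: n p => [//|n IH] p; have [d e] := derive1_is _ _ (@is_derive_poly R p).
by split => //; rewrite e; exact: IH.
Qed.

(** Every factor X is absorbed by half of the exponential rate, so the induction needs all rates [a]
    at once. *)
Lemma poly_le_expR p (a : R) : 0 < a ->
  exists2 C : R, 0 <= C & forall y, 0 <= y -> `|p.[y]| <= C * expR (a * y).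
Proof.
elim/poly_ind: p a => [|p c IH] a a0.
  by exists 0 => // y y0; rewrite horner0 normr0 mul0r.
have [|C C0 hC] := IH (a / 2); first by lra.
exists (C * (2 / a) + `|c|).
  by rewrite addr_ge0 // mulr_ge0 // divr_ge0 // ltW.
move=> y y0; rewrite hornerD hornerM hornerX hornerC.
apply: (le_trans (ler_normD _ _)); rewrite normrM (ger0_norm y0) mulrDl.
have e1 : 1 <= expR (a * y).
  by apply: le_trans (expR_ge1Dx _); rewrite lerDl mulr_ge0 // ltW.
apply: lerD; last by rewrite ler_peMr.
have -> : a * y = a / 2 * y + a / 2 * y by field.
rewrite expRD; have e0 := expR_ge0 (a / 2 * y).
have h : y <= 2 / a * expR (a / 2 * y).
  rewrite mulrAC ler_pdivlMr //; have := expR_ge1Dx (a / 2 * y); lra.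
apply: (@le_trans _ _ (C * expR (a / 2 * y) * (2 / a * expR (a / 2 * y)))).
  by apply: ler_pM => //; exact: hC.
by rewrite le_eqVlt; apply/orP; left; apply/eqP; ring.
Qed.

(* Flat functions [p(1/x) exp(-1/x)] on [x > 0]; the family is closed under
   differentiation. *)
Definition flat p x : R := if 0 < x then p.[x^-1] * expR (- x^-1) else 0.

Lemma flat_le p : exists2 C : R, 0 <= C & forall x, `|flat p x| <= C.
Proof.
have [|C C0 hC] := poly_le_expR p 1; first by [].
exists C => // x; rewrite /flat; case: ifP => x0; last by rewrite normr0.
rewrite normrM (ger0_norm (expR_ge0 _)) expRN ler_pdivrMr ?expR_gt0 //.
by have := hC x^-1; rewrite mul1r; apply; rewrite invr_ge0 ltW.
Qed.

Lemma flat_mulX p n x : 0 < x -> flat (p * 'X^n) x = flat p x / x ^+ n.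
Proof. by move=> x0; rewrite /flat x0 hornerM hornerXn exprVn mulrAC. Qed.

Lemma flat_le_exp p n : exists2 C : R, 0 <= C & forall x, `|flat p x| <= C * `|x| ^+ n.
Proof.
have [C C0 hC] := flat_le (p * 'X^n); exists C => // x.
have [x0|x0] := ltP 0 x; last first.
  by rewrite /flat (ltNge 0 x) x0 normr0 mulr_ge0 // exprn_ge0.
have := hC x; rewrite flat_mulX // normrM normfV normrX ler_pdivrMr //.
by rewrite exprn_gt0 // normr_gt0 gt_eqF.
Qed.

Lemma flat_derive p x : is_derive x 1 (flat p) (flat ('X^2 * (p - p^`())) x).
Proof.
have [x0|x0|->] := ltgtP x 0.
- rewrite [X in is_derive _ _ _ X]/flat (lt_gtF x0).
  apply: (@near_eq_is_derive _ _ _ (cst 0 : R -> R)).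
  near=> y; rewrite /flat lt_gtF //; near: y; exact: lt_nbhsl.
- rewrite [X in is_derive _ _ _ X]/flat x0.
  have xn0 : x != 0 by rewrite gt_eqF.
  apply: (@near_eq_is_derive _ _ _ ((horner p * (expR \o -%R)) \o (fun y : R => y^-1))).
    near=> y; rewrite /flat ifT //=; near: y; exact: lt_nbhsr.
  have dV : is_derive x 1 (fun y : R => y^-1) (- x ^- 2).
    have h : is_derive x 1 (fun y : R => (id y)^-1) (- (id x) ^- 2 *: 1).
      exact: is_deriveV.
    by apply: is_derive_eq h _; rewrite /GRing.scale /= mulr1.
  have dN : is_derive x^-1 1 (-%R : R -> R) (-1) by exact: is_deriveNid.
  have dE : is_derive x^-1 1 (expR \o -%R) (expR (- x^-1) * -1).
    exact: is_derive1_comp.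
  have dp := @is_derive_poly R p x^-1.
  have dm := @is_deriveM _ _ _ _ _ _ _ _ dp dE.
  apply: is_derive_eq (@is_derive1_comp _ _ (fun y : R => y^-1) _ _ _ dm dV) _.
  rewrite /GRing.scale /= !(hornerD, hornerN, hornerM, horner_exp, hornerX, hornerC); field.
  exact: xn0.
rewrite [X in is_derive _ _ _ X]/flat ltxx.
(* Caratheodory's slope function at 0; its value there is the default 0/0 = 0, and the quadratic
   bound from [flat_le_exp] makes it continuous. *)
apply/is_derive1_caratheodory; exists (fun z => flat p z / z); split.
- move=> z; rewrite subr0 {2}/flat ltxx subr0; have [->|z0] := eqVneq z 0.
    by rewrite mulr0 /flat ltxx.
  by rewrite divfK.
- have [C C0 hC] := flat_le_exp p 2.
  apply/cvgrPdist_le => e e0; rewrite [flat p 0 / 0](_ : _ = 0); last by rewrite invr0 mulr0.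
  near=> z; rewrite sub0r normrN normrM normfV.
  have [->|z0] := eqVneq z 0; first by rewrite normr0 invr0 mulr0 ltW.
  rewrite ler_pdivrMr ?normr_gt0 //; apply: (le_trans (hC z)).
  rewrite expr2 mulrA ler_wpM2r //.
  have zC : `|z| <= e / (C + 1).
    near: z; exists (e / (C + 1)) => /=; first by rewrite divr_gt0 //; lra.
    by move=> y /=; rewrite sub0r normrN => /ltW.
  move: zC; rewrite ler_pdivlMr; last by lra.
  have := normr_ge0 z; nra.
- by rewrite /flat ltxx mul0r.
Unshelve. all: by end_near. Qed.

Lemma Ck_flat n p : Ck n (flat p).
Proof.
elim: n p => [//|n IH] p; have [d e] := derive1_is _ _ (flat_derive p).
by split => //; rewrite e; exact: IH.
Qed.

(** From exp(-y) >= 1 - y. The cut-off composes [flat 1] with a polynomial [g n] for which g + 1 =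
    (n+1)(1 - x^2), so the last bound makes its distance to 1 at most 2/((n+1)(1 - x^2)). *)
Lemma flat1_dist x : 0 <= 1 - flat 1 x /\ 1 - flat 1 x <= 1 /\ (x + 1) * (1 - flat 1 x) <= 2.
Proof.
rewrite /flat hornerC mul1r; case: ifP => [x0|/negbT]; last first.
  by rewrite -leNgt subr0 mulr1; lra.
have e0 := expR_gt0 (- x^-1).
have e1 : expR (- x^-1) <= 1 by rewrite expR_le1 oppr_le0 invr_ge0 ltW.
have e2 := expR_ge1Dx (- x^-1).
have x1 : x * x^-1 = 1 by rewrite divff // gt_eqF.
set y := x^-1 in e0 e1 e2 x1 *; split; first by lra.
split; first by lra.
have : x * (1 - expR (- y)) <= x * y by rewrite ler_pM2l //; lra.
by rewrite x1 mulrDl mul1r; lra.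
Qed.

Lemma flat2_dist : exists2 B : R, 0 <= B & forall x, -1 <= x ->
  (x + 1) * `|flat 'X^2 x| <= B /\ (x + 1) ^+ 2 * `|flat 'X^2 x| <= B.
Proof.
have [B B0 hB] := flat_le ('X + 1 : {poly R}).
have [B' B'0 hB'] := flat_le (('X + 1) ^+ 2 : {poly R}).
have [B2 B20 hB2] := flat_le (('X + 1) * 'X: {poly R}).
exists (B2 + B'); first by rewrite addr_ge0.
move=> x x1; have [x0|x0] := ltP 0 x; last first.
  by rewrite /flat (ltNge 0 x) x0 normr0 !mulr0 addr_ge0.
have xn0 : x != 0 by rewrite gt_eqF.
have := hB' x; have := hB2 x; rewrite /flat x0 !normrM.
rewrite !(hornerD, hornerN, hornerM, horner_exp, hornerX, hornerC).
have -> : x + 1 = x * (x^-1 + 1) by field.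
set e := `|expR _|; have y0 : 0 < x^-1 by rewrite invr_gt0.
rewrite ?normrX !normrM ?normrX (gtr0_norm y0) (gtr0_norm (_ : 0 < x^-1 + 1)); last by lra.
move=> h2 h'; split.
  apply: (@le_trans _ _ B2); last by lra.
  apply: le_trans h2; rewrite le_eqVlt; apply/orP; left; apply/eqP; field.
  exact: xn0.
apply: (@le_trans _ _ B'); last by lra.
apply: le_trans h'; rewrite le_eqVlt; apply/orP; left; apply/eqP; field.
exact: xn0.
Qed.

Lemma poly_bound p : exists2 B : R, 0 <= B & forall x, -1 <= x -> x <= 1 -> `|p.[x]| <= B.
Proof.
have [||c _ hc] := @EVT_max R (fun x => `|p.[x]|) (-1) 1.
- by lra.
- apply: continuous_subspaceT => x; apply: continuous_comp; last exact: norm_continuous.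
  exact: continuous_horner.
by exists `|p.[c]| => // x x1 x2; apply: hc; rewrite in_itv /= x1 x2.
Qed.

Lemma poly_vanish p : p.[-1] = 0 -> p.[1] = 0 -> exists q, p = (1 - 'X^2) * q.
Proof.
move=> /eqP; rewrite -/(root p (-1)) => /factor_theorem [q ->].
rewrite hornerM hornerD hornerN hornerX hornerC => /eqP.
rewrite mulf_eq0 opprK (_ : 1 + 1 == 0 :> R = false) ?orbF; last first.
  by rewrite (_ : 1 + 1 = 2%:R :> R) ?pnatr_eq0 //; ring.
rewrite -/(root q 1) => /factor_theorem [r ->]; exists (- r).
rewrite polyCN polyC1; ring.
Qed.

(* [cutoff n] tends to 1 on the interval, and its derivative, which blows up
   near the ends, is tamed by the linear vanishing of [p]. *)
Lemma cutoff_approx p : p.[-1] = 0 -> p.[1] = 0 ->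
  exists (phi : nat -> R -> R), exists2 B : R, 0 <= B &
  (forall n, test_fun (phi n)) /\
  forall n x, -1 < x -> x < 1 -> [/\
     `|phi n x - p.[x]| <= B, `|derive1 (phi n) x - p^`().[x]| <= B,
     (n%:R * (1 - x ^+ 2)) * `|phi n x - p.[x]| <= B &
     (n%:R * (1 - x ^+ 2)) * `|derive1 (phi n) x - p^`().[x]| <= B].
Proof.
move=> pm p1; have [q pq] := poly_vanish p pm p1.
have [A A0 hA] := poly_bound q.
have [B B0 hB] := poly_bound p.
have [B' B'0 hB'] := poly_bound p^`().
have [D D0 hD] := flat2_dist.
(* [g n] is positive exactly where 1 - x^2 > 1/(n+1), so [flat 1] of it vanishes near both end
   points. *)
pose g n : {poly R} := n.+1%:R *: (1 - 'X^2) - 1.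
have gE n x : (g n).[x] = n.+1%:R * (1 - x ^+ 2) - 1.
  by rewrite /g !(hornerD, hornerN, hornerZ, horner_exp, hornerX, hornerC).
have dgE n x : (g n)^`().[x] = - (2 * n.+1%:R * x).
  rewrite /g derivB derivZ -polyC1 derivC subr0 derivB derivC sub0r derivXn /= expr1.
  by rewrite hornerZ hornerN hornerMn hornerX; ring.
pose phi n := (flat 1 \o horner (g n)) * horner p.
have d1 : ('X^2 * (1 - 1^`()) : {poly R}) = 'X^2 by rewrite -polyC1 derivC subr0 mulr1.
have dphi n x : derive1 (phi n) x =
    flat 1 (g n).[x] * p^`().[x] - p.[x] * (flat 'X^2 (g n).[x] * (2 * n.+1%:R * x)).
  have [|_ ->] := @derive1_is (phi n) (fun x => 
    flat 1 (g n).[x] * p^`().[x] + p.[x] * (flat 'X^2 (g n).[x] * (g n)^`().[x])).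
    move=> y; have h1 := is_derive_poly p y; have h2 := is_derive_poly (g n) y.
    have := flat_derive 1 (g n).[y]; rewrite d1 => h3.
    have h4 := @is_derive1_comp _ _ (horner (g n)) _ _ _ h3 h2.
    exact: (@is_deriveM _ _ _ _ _ _ _ _ h4 h1).
  by rewrite dgE mulrN mulrN.
exists phi, (2 * B + 2 * B' + 2 * A * D); first by rewrite !addr_ge0 ?mulr_ge0.
split.
  move=> n; split.
    by apply: Ck_derive1n => k; apply: CkM; [apply: Ck_comp; [exact: Ck_flat|] | ]; exact: Ck_poly.
  (* Chosen so that b^2 >= 1 - 1/(n+1): beyond b in absolute value, [g n] is nonpositive. *)
  pose b : R := 1 - (2 * n.+1%:R)^-1.
  have n0 : 0 < n.+1%:R :> R by rewrite ltr0n.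
  have nn : n.+1%:R * n.+1%:R^-1 = 1 :> R by rewrite divff // gt_eqF.
  have n1 : 1 <= n.+1%:R :> R by rewrite ler1n.
  have i0 : 0 < n.+1%:R^-1 :> R by rewrite invr_gt0.
  have i1 : n.+1%:R^-1 <= 1 :> R by rewrite invf_le1.
  have bE : b = 1 - n.+1%:R^-1 / 2 by rewrite /b invfM mulrC.
  clearbody b; set i := n.+1%:R^-1 in nn i0 i1 bE.
  exists (- b), b; split; [by lra|split; [by lra|]] => x xb.
  rewrite /phi fctE /= /flat ifF ?mul0r //; apply/negbTE; rewrite -leNgt gE.
  rewrite subr_le0 -[leRHS]nn ler_pM2l //.
  have : b ^+ 2 <= x ^+ 2 by case: xb => xb; nra.
  rewrite bE; nra.
move=> n x x1 x2.
have w0 : 0 < 1 - x ^+ 2 by nra.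
have w1 : 1 - x ^+ 2 <= 1 by have := sqr_ge0 x; lra.
have n1 : 1 <= n.+1%:R :> R by rewrite ler1n.
have nn0 : (0 : R) <= n%:R := ler0n _ _.
have nn : (n%:R : R) <= n.+1%:R by rewrite ler_nat.
have s1 : -1 <= (g n).[x] by rewrite gE; nra.
have [E0 [E1 E2]] := flat1_dist (g n).[x].
have [F1 F2] := hD _ s1.
have s1E : (g n).[x] + 1 = n.+1%:R * (1 - x ^+ 2) by rewrite gE; ring.
rewrite s1E in E2 F1 F2.
(* This factor 1 - x^2 pays for the factor n+1 that the chain rule produces: together they form the
   quantity [s] that [flat2_dist] bounds. *)
have px : `|p.[x]| <= A * (1 - x ^+ 2).
  rewrite pq !(hornerD, hornerN, hornerM, horner_exp, hornerX, hornerC) normrM mulrC.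
  by rewrite (gtr0_norm w0) ler_pM2r // hA // ltW.
have px' := hB x (ltW x1) (ltW x2); have dpx := hB' x (ltW x1) (ltW x2).
have e1 : `|phi n x - p.[x]| = (1 - flat 1 (g n).[x]) * `|p.[x]|.
  have -> : phi n x - p.[x] = - ((1 - flat 1 (g n).[x]) * p.[x]) by rewrite /phi fctE /=; ring.
  by rewrite normrN normrM (ger0_norm E0).
have e2 : `|derive1 (phi n) x - p^`().[x]| <= (1 - flat 1 (g n).[x]) * B' +
     2 * A * (n.+1%:R * (1 - x ^+ 2) * `|flat 'X^2 (g n).[x]|).
  rewrite dphi.
  have -> : flat 1 (g n).[x] * p^`().[x] - p.[x] * (flat 'X^2 (g n).[x] * (2 * n.+1%:R * x)) - p^`().[x]
     = - ((1 - flat 1 (g n).[x]) * p^`().[x]) - p.[x] * (flat 'X^2 (g n).[x] * (2 * n.+1%:R * x)) by ring.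
  apply: (le_trans (ler_normB _ _)); rewrite normrN; apply: lerD.
    by rewrite normrM (ger0_norm E0) ler_wpM2l.
  rewrite !normrM (@ger0_norm _ n.+1%:R) // (@ger0_norm _ 2) //.
  have x3 : `|x| <= 1 by rewrite ler_norml; apply/andP; split; lra.
  set F := `|flat _ _|; have F0 : 0 <= F by exact: normr_ge0.
  apply: (@le_trans _ _ ((A * (1 - x ^+ 2)) * (F * (2 * n.+1%:R * 1)))).
    apply: ler_pM => //; first by rewrite !mulr_ge0.
    by apply: ler_wpM2l => //; apply: ler_wpM2l => //; lra.
  by rewrite le_eqVlt; apply/orP; left; apply/eqP; ring.
set s := n.+1%:R * (1 - x ^+ 2) in E2 F1 F2 e2.
have ns : n%:R * (1 - x ^+ 2) <= s by rewrite ler_pM2r.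
have s0 : 0 <= n%:R * (1 - x ^+ 2) by rewrite mulr_ge0 // ltW.
set E := 1 - flat 1 _ in E0 E1 E2 e1 e2; set F := `|flat _ _| in F1 F2 e2.
have F0 : 0 <= F by exact: normr_ge0.
have AD : 0 <= A * D by rewrite mulr_ge0.
split.
- rewrite e1; apply: (@le_trans _ _ (1 * B)); [by apply: ler_pM | by lra].
- apply: (le_trans e2).
  have : E * B' <= 1 * B' by rewrite ler_wpM2r.
  have : A * (s * F) <= A * D by rewrite ler_wpM2l.
  lra.
- rewrite e1; apply: (@le_trans _ _ (s * (E * `|p.[x]|))).
    by rewrite ler_wpM2r // mulr_ge0.
  rewrite mulrA; apply: (@le_trans _ _ (2 * B)); last by lra.
  by apply: ler_pM => //; rewrite mulr_ge0 //; lra.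
apply: (@le_trans _ _ (s * (E * B' + 2 * A * (s * F)))).
  by apply: ler_pM.
have : (s * E) * B' <= 2 * B' by rewrite ler_wpM2r.
have : A * (s ^+ 2 * F) <= A * D by rewrite ler_wpM2l.
lra.
Qed.

End SmoothCutoff.

(** * Weighted L^2 spaces on I *)

Section WeightedL2.
Variable R : realType.
Local Open Scope classical_set_scope.
Local Open Scope ring_scope.
Implicit Types (w h k g : R -> R) (x a b e : R).
Notation mu := (@lebesgue_measure R).

(* The sigma-algebra on which the Lebesgue measure is declared; it is
   convertible to the canonical one of [R]. *)
Notation mfun h := (@measurable_fun _ _ (measurableTypeR R) R (@I R) h).

Definition integ h := mu.-integrable (@I R) (EFin \o h).

(** General enough for the constant 1 and [omega], so that one theory serves the L^2 norm and the
    energy norm. *)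
Definition weight w := mfun w /\ forall x, -1 < x -> x < 1 -> 0 <= w x <= 1.

Definition L2w w h := mfun h /\ integ (fun x => w x * h x ^+ 2).

Definition ip w h k : R := intI (fun x => w x * h x * k x).

Definition nrm w h : R := Num.sqrt (ip w h h).

Lemma measurableI : @measurable _ (measurableTypeR R) (@I R). Proof. exact: measurable_itv. Qed.
Hint Resolve measurableI : core.

Lemma inI x : I x <-> -1 < x /\ x < 1.
Proof. by rewrite /I /= in_itv /=; split => [/andP[]|[-> ->]]. Qed.

Lemma eq_intI h k : (forall x, -1 < x -> x < 1 -> h x = k x) -> intI h = intI k.
Proof. by move=> e; apply: eq_Rintegral => x /set_mem /inI [x1 x2]; exact: e. Qed.

Lemma eq_integ h k : (forall x, -1 < x -> x < 1 -> h x = k x) -> integ h -> integ k.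
Proof.
move=> e; apply: eq_integrable => //.
by move=> x /set_mem /inI [x1 x2]; rewrite /= e.
Qed.

Lemma integD h k a b : integ h -> integ k -> integ (fun x => a * h x + b * k x).
Proof.
move=> ih ik; have := integrableD measurableI (integrableZl measurableI a ih) (integrableZl measurableI b ik).
by apply: eq_integrable => // x _.
Qed.

Lemma intID h k a b : integ h -> integ k ->
  intI (fun x => a * h x + b * k x) = a * intI h + b * intI k.
Proof.
move=> ih ik; rewrite /intI RintegralD //.
- by rewrite !RintegralZl.
- by have := integrableZl measurableI a ih; apply: eq_integrable.
- by have := integrableZl measurableI b ik; apply: eq_integrable.
Qed.

Lemma integ_le h k : mfun h ->
  (forall x, -1 < x -> x < 1 -> `|h x| <= k x) -> integ k -> integ h.
Proof.
move=> mh hk; apply: le_integrable => //; first exact/measurable_EFinP.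
move=> x /inI [x1 x2]; rewrite /= lee_fin; apply: (le_trans (hk x x1 x2)).
exact: ler_norm.
Qed.

Lemma le_intI h k : integ h -> integ k ->
  (forall x, -1 < x -> x < 1 -> h x <= k x) -> intI h <= intI k.
Proof. by move=> ih ik hk; apply: le_Rintegral => // x /inI [x1 x2]; exact: hk. Qed.

Lemma lebesgue_I : mu (@I R) = 2%:E.
Proof.
rewrite lebesgue_measure_itv /= lte_fin ifT; last by lra.
by rewrite -EFinB; congr EFin; ring.
Qed.

Lemma lebesgue_I_fin : (mu (@I R) < +oo)%E. Proof. by rewrite lebesgue_I ltry. Qed.

Lemma integ_bounded h b : mfun h ->
  (forall x, -1 < x -> x < 1 -> `|h x| <= b) -> integ h.
Proof.
move=> mh hb; apply: measurable_bounded_integrable => //; first exact: lebesgue_I_fin.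
exists b; split; first exact: num_real.
by move=> c bc x /inI [x1 x2]; apply: le_trans (hb x x1 x2) (ltW bc).
Qed.

Lemma intI_cst a : intI (fun=> a) = 2 * a.
Proof.
transitivity (a * fine (mu (@I R))); first exact: Rintegral_cst.
by rewrite lebesgue_I /= mulrC.
Qed.

Section Weight.
Variable w : R -> R.
Hypothesis wP : weight w.

Let w0 x : -1 < x -> x < 1 -> 0 <= w x.
Proof. by move=> x1 x2; have [_ /(_ x x1 x2) /andP[]] := wP. Qed.
Let w1 x : -1 < x -> x < 1 -> w x <= 1.
Proof. by move=> x1 x2; have [_ /(_ x x1 x2) /andP[]] := wP. Qed.

Lemma integ_ip h k : L2w w h -> L2w w k -> integ (fun x => w x * h x * k x).
Proof.
move=> [mh ih] [mk ik]; have mw := wP.1.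
apply: (integ_le _ (fun x => 1 * (w x * h x ^+ 2) + 1 * (w x * k x ^+ 2))).
- by do 2!apply: measurable_funM => //.
- move=> x x1 x2; have := w0 x x1 x2; rewrite -mulrA normrM => wx; rewrite (ger0_norm wx).
  rewrite !mul1r -mulrDr ler_wpM2l // normrM.
  rewrite -(@real_normK _ (h x)) ?num_real // -(@real_normK _ (k x)) ?num_real //.
  have := sqr_ge0 (`|h x| - `|k x|); have := mulr_ge0 (normr_ge0 (h x)) (normr_ge0 (k x)); nra.
- exact: integD.
Qed.

Lemma L2wD h k a b : L2w w h -> L2w w k -> L2w w (fun x => a * h x + b * k x).
Proof.
move=> hh kk; have [mh ih] := hh; have [mk ik] := kk; split.
  by apply: measurable_funD; apply: measurable_funM.
have := integD _ _ 1 (2 * a * b) (integD _ _ (a ^+ 2) (b ^+ 2) ih ik) (integ_ip _ _ hh kk).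
by apply: eq_integ => x _ _; ring.
Qed.

Lemma eq_L2w h k : (forall x, -1 < x -> x < 1 -> h x = k x) -> L2w w h -> L2w w k.
Proof.
move=> e [mh ih]; split; last by apply: eq_integ ih => x x1 x2; rewrite e.
by apply: eq_measurable_fun mh => x /set_mem /inI [x1 x2]; exact: e.
Qed.

Lemma L2wB h k : L2w w h -> L2w w k -> L2w w (fun x => h x - k x).
Proof.
move=> hh kk; have := L2wD h k 1 (-1) hh kk.
by apply: eq_L2w => x _ _; ring.
Qed.

Lemma L2w_bounded h b : mfun h ->
  (forall x, -1 < x -> x < 1 -> `|h x| <= b) -> L2w w h.
Proof.
move=> mh hb; split => //; apply: (integ_bounded _ (b ^+ 2)).
  by apply: measurable_funM; [exact: wP.1|apply: measurable_funX].
move=> x x1 x2; have := hb x x1 x2; have := w0 x x1 x2; have := w1 x x1 x2.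
rewrite normrM normrX => w1x w0x hx; rewrite (ger0_norm w0x).
have : `|h x| ^+ 2 <= b ^+ 2 by rewrite ler_pXn2r // nnegrE (le_trans _ hx).
have := sqr_ge0 `|h x|; nra.
Qed.

Lemma eq_ip h k h' k' : (forall x, -1 < x -> x < 1 -> h x = h' x) ->
  (forall x, -1 < x -> x < 1 -> k x = k' x) -> ip w h k = ip w h' k'.
Proof. by move=> e e'; apply: eq_intI => x x1 x2; rewrite e // e'. Qed.

Lemma ipC h k : ip w h k = ip w k h.
Proof. by apply: eq_intI => x _ _; ring. Qed.

Lemma ipDl h k g a b : L2w w h -> L2w w k -> L2w w g ->
  ip w (fun x => a * h x + b * k x) g = a * ip w h g + b * ip w k g.
Proof.
move=> hh kk gg; rewrite -intID; [|exact: integ_ip|exact: integ_ip].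
by apply: eq_intI => x _ _; ring.
Qed.

Lemma ipBl h k g : L2w w h -> L2w w k -> L2w w g ->
  ip w (fun x => h x - k x) g = ip w h g - ip w k g.
Proof.
move=> hh kk gg; have := ipDl h k g 1 (-1) hh kk gg.
rewrite mul1r mulN1r => <-; apply: eq_ip => // x _ _; ring.
Qed.

Lemma ip_ge0 h : 0 <= ip w h h.
Proof.
apply: Rintegral_ge0 => x /inI [x1 x2]; rewrite -mulrA -expr2.
by rewrite mulr_ge0 ?sqr_ge0 ?w0.
Qed.

Lemma ip_cs h k : L2w w h -> L2w w k -> ip w h k ^+ 2 <= ip w h h * ip w k k.
Proof.
move=> hh kk; set A := ip w h h; set B := ip w h k; set C := ip w k k.
have q a b : 0 <= a ^+ 2 * A + 2 * a * b * B + b ^+ 2 * C.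
  have := ip_ge0 (fun x => a * h x + b * k x).
  have hk := L2wD h k a b hh kk.
  rewrite ipDl // (ipC h) (ipC k) !ipDl // (ipC k h) -/A -/B -/C; congr (_ <= _); ring.
have A0 : 0 <= A := ip_ge0 h; have C0 : 0 <= C := ip_ge0 k.
have [A1|A1] := leP A 0.
  have AE : A = 0 by apply/eqP; rewrite eq_le A1 A0.
  have [->|B0] := eqVneq B 0; first by rewrite expr0n /= mulr_ge0.
  (* When A = 0 the quadratic form is affine in its first argument; this choice gives it the value
     -C - 2, which is negative. *)
  have := q (- (C + 1) / B) 1; rewrite AE.
  have -> : (- (C + 1) / B) ^+ 2 * 0 + 2 * (- (C + 1) / B) * 1 * B + 1 ^+ 2 * C = - C - 2 by field.
  lra.
have := q B (- A).
have -> : B ^+ 2 * A + 2 * B * - A * B + (- A) ^+ 2 * C = A * (A * C - B ^+ 2) by ring.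
by rewrite pmulr_rge0 // subr_ge0.
Qed.

Lemma nrm_ge0 h : 0 <= nrm w h. Proof. exact: sqrtr_ge0. Qed.

Lemma nrm_sqr h : nrm w h ^+ 2 = ip w h h.
Proof. by rewrite sqr_sqrtr // ip_ge0. Qed.

Lemma ip_le_nrm h k : L2w w h -> L2w w k -> `|ip w h k| <= nrm w h * nrm w k.
Proof.
move=> hh kk; rewrite -(@ler_pXn2r _ 2) // ?nnegrE ?mulr_ge0 ?nrm_ge0 //.
by rewrite real_normK ?num_real // exprMn !nrm_sqr ip_cs.
Qed.

Lemma eq_nrm h k : (forall x, -1 < x -> x < 1 -> h x = k x) -> nrm w h = nrm w k.
Proof. by move=> e; rewrite /nrm (eq_ip h h k k). Qed.

Lemma nrmD h k : L2w w h -> L2w w k -> nrm w (fun x => h x + k x) <= nrm w h + nrm w k.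
Proof.
move=> hh kk; rewrite -(@ler_pXn2r _ 2) // ?nnegrE ?addr_ge0 ?nrm_ge0 //.
have hk := L2wD h k 1 1 hh kk.
rewrite (eq_nrm _ (fun x => 1 * h x + 1 * k x)); last by move=> x _ _; ring.
rewrite nrm_sqr ipDl // (ipC h) (ipC k) !ipDl // (ipC k h).
have := ip_le_nrm h k hh kk; rewrite ler_norml => /andP[_ h2].
rewrite sqrrD !nrm_sqr; lra.
Qed.

Lemma nrmZ h a : L2w w h -> nrm w (fun x => a * h x) = `|a| * nrm w h.
Proof.
move=> hh; rewrite /nrm; suff -> : ip w (fun x => a * h x) (fun x => a * h x) = a ^+ 2 * ip w h h.
  by rewrite sqrtrM ?sqr_ge0 // sqrtr_sqr.
have hh0 := L2wD h h a 0 hh hh.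
transitivity (ip w (fun x => a * h x + 0 * h x) (fun x => a * h x + 0 * h x)).
  by apply: eq_ip => x _ _; ring.
by rewrite ipDl // (ipC h) ipDl //; ring.
Qed.

Lemma nrmB h k : L2w w h -> L2w w k -> nrm w (fun x => h x - k x) <= nrm w h + nrm w k.
Proof.
move=> hh kk; have kN : L2w w (fun x => -1 * k x).
  have := L2wD k k (-1) 0 kk kk; apply: eq_L2w => x _ _; ring.
have := nrmD h _ hh kN; rewrite nrmZ // normrN1 mul1r; apply: le_trans.
rewrite le_eqVlt; apply/orP; left; apply/eqP; apply: eq_nrm => x _ _; ring.
Qed.

Lemma nrm_bounded h e : 0 <= e -> mfun h ->
  (forall x, -1 < x -> x < 1 -> `|h x| <= e) -> nrm w h <= 2 * e.
Proof.
move=> e0 mh he; have hh := L2w_bounded h e mh he.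
rewrite -(@ler_pXn2r _ 2) // ?nnegrE ?nrm_ge0 //; last by rewrite mulr_ge0.
rewrite nrm_sqr; apply: (@le_trans _ _ (intI (fun=> e ^+ 2))); last first.
  by rewrite intI_cst; have := sqr_ge0 e; lra.
apply: le_intI; first exact: integ_ip.
  by apply: (integ_bounded _ `|e ^+ 2|) => //; exact: measurable_cst.
move=> x x1 x2; rewrite -mulrA -expr2 -real_normK ?num_real //.
have : `|h x| ^+ 2 <= e ^+ 2 by rewrite ler_pXn2r // ?nnegrE // he.
have := w0 x x1 x2; have := w1 x x1 x2; have := sqr_ge0 `|h x|; nra.
Qed.

End Weight.

Lemma weight1 : weight (fun=> 1).
Proof. by split => [|x _ _]; [exact: measurable_cst | rewrite ler01 lexx]. Qed.

Lemma measurable_continuous h : continuous h -> mfun h.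
Proof. by move=> ch; apply: measurable_funTS; exact: continuous_measurable_fun. Qed.

Lemma weight_omega : weight (@omega R).
Proof.
split; first exact: measurable_continuous (@omega_continuous R).
by move=> x _ _; rewrite omega_ge0 omega_le1.
Qed.

Lemma L2w_omega h : L2w (fun=> 1) h -> L2w (@omega R) h.
Proof.
move=> [mh ih]; split => //; apply: integ_le ih.
  by apply: measurable_funM; [exact: weight_omega.1|apply: measurable_funX].
move=> x x1 x2; rewrite mul1r normrM (ger0_norm (omega_ge0 _ _)) (ger0_norm (sqr_ge0 _)).
by rewrite ler_piMl ?sqr_ge0 // omega_le1.
Qed.

Lemma nrm_omega_le h : L2w (fun=> 1) h -> nrm (@omega R) h <= nrm (fun=> 1) h.
Proof.
move=> hh; rewrite ler_wsqrtr //; apply: le_intI.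
- by apply: integ_ip; [exact: weight_omega|exact: L2w_omega|exact: L2w_omega].
- by apply: integ_ip => //; exact: weight1.
move=> x x1 x2; rewrite mul1r -mulrA -expr2 ler_piMl ?sqr_ge0 // omega_le1 //.
Qed.

Lemma L2w_poly w (p : {poly R}) : weight w -> L2w w (horner p).
Proof.
move=> wP; have [B B0 hB] := @poly_bound R p; apply: (L2w_bounded _ wP _ B).
  by apply: measurable_continuous; exact: continuous_horner.
by move=> x x1 x2; apply: hB; exact: ltW.
Qed.

Lemma L2_L2w h : L2 h -> L2w (fun=> 1) h.
Proof.
move=> [mh ih]; split => //; apply/integrableP; split.
  apply/measurable_EFinP; apply: measurable_funM; first exact: measurable_cst.
  exact: measurable_funX.
apply: le_lt_trans ih; apply: ge0_le_integral => //.
- apply: measurableT_comp => //; apply/measurable_EFinP.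
  by apply: measurable_funM; [exact: measurable_cst|exact: measurable_funX].
- by apply/measurable_EFinP; exact: measurable_funX.
- by move=> x _; rewrite /= lee_fin mul1r ger0_norm ?sqr_ge0.
Qed.

End WeightedL2.

(** * Extending weak identities beyond test functions *)

Section WeakDerivatives.
Variable R : realType.
Local Open Scope classical_set_scope.
Local Open Scope ring_scope.
Implicit Types (w h k g u du f F : R -> R) (x a b e : R) (p q : {poly R}).
Notation mu := (@lebesgue_measure R).
Notation mfun h := (@measurable_fun _ _ (measurableTypeR R) R (@I R) h).
Notation one := (fun=> 1 : R).

Lemma intI_FTC F f : (forall x, -1 < x -> x < 1 -> is_derive x 1 F (f x)) ->
  continuous F -> continuous f -> intI f = F 1 - F (-1).
Proof.
move=> dF cF cf.
have N11 : (-1 : R) < 1 by lra.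
have icc : mu.-integrable `[-1, 1] (EFin \o f).
  apply: continuous_compact_integrable; first exact: segment_compact.
  exact: continuous_subspaceT.
have sub : `[-1, 1[ `<=` (`[-1, 1] : set R) by move=> x /=; rewrite !in_itv /= => /andP[-> /ltW].
have sub' : `]-1, 1[ `<=` (`[-1, 1[ : set R) by move=> x /=; rewrite !in_itv /= => /andP[/ltW -> ].
have ico : mu.-integrable `[-1, 1[ (EFin \o f) by apply: (@integrableS _ _ _ mu `[-1, 1] `[-1, 1[ _ _ _ sub icc); exact: measurable_itv.
have ioo : mu.-integrable `]-1, 1[ (EFin \o f) by apply: (@integrableS _ _ _ mu `[-1, 1[ `]-1, 1[ _ _ _ sub' ico); exact: measurable_itv.
rewrite /intI /I Rintegral_itv_obnd_cbnd // Rintegral_itv_bndo_bndc //.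
rewrite /Rintegral (@continuous_FTC2 _ f F) //.
- exact: continuous_subspaceT.
- split.
  + by move=> x; rewrite in_itv /= => /andP[x1 x2]; have := dF x x1 x2 => h; exact: ex_derive.
  + by apply: cvg_at_right_filter; exact: cF.
  + by apply: cvg_at_left_filter; exact: cF.
- by move=> x; rewrite in_itv /= => /andP[x1 x2]; have := dF x x1 x2 => h; rewrite derive1E derive_val.
Qed.

Lemma L2w_continuous w h : weight R w -> continuous h -> L2w R w h.
Proof.
move=> wP ch.
have [||c _ hc] := @EVT_max R (fun x => `|h x|) (-1) 1.
- by lra.
- apply: continuous_subspaceT => x; apply: continuous_comp; last exact: norm_continuous.
  exact: ch.
apply: (L2w_bounded _ _ wP _ `|h c|); first exact: measurable_continuous.
by move=> x x1 x2; apply: hc; rewrite in_itv /= !ltW.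
Qed.

Lemma nrm_le_pointwise w h e : weight R w -> L2w R w h -> 0 <= e ->
  (forall x, -1 < x -> x < 1 -> w x * h x ^+ 2 <= e ^+ 2) -> nrm R w h <= 2 * e.
Proof.
move=> wP hh e0 he.
rewrite -(@ler_pXn2r _ 2) // ?nnegrE ?nrm_ge0 //; last by rewrite mulr_ge0.
rewrite nrm_sqr //; apply: (@le_trans _ _ (intI (fun=> e ^+ 2))); last first.
  by rewrite intI_cst; have := sqr_ge0 e; lra.
apply: le_intI; first exact: integ_ip.
  by apply: (integ_bounded _ _ `|e ^+ 2|) => //; exact: measurable_cst.
by move=> x x1 x2; rewrite -mulrA -expr2 he.
Qed.

(** The two bounds are those that [cutoff_approx] supplies: the first dominates, the second gives
    convergence at each interior point, where 1 - x^2 is positive though not bounded away from 0. *)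
Lemma nrm_dominated_cvg w (h : nat -> R -> R) b : weight R w -> (forall n, mfun (h n)) ->
  (forall n x, -1 < x -> x < 1 -> `|h n x| <= b) ->
  (forall n x, -1 < x -> x < 1 -> n%:R * (1 - x ^+ 2) * `|h n x| <= b) ->
  nrm R w (h n) @[n --> \oo] --> 0.
Proof.
move=> wP mh hb hd; have [mw w01] := wP.
have b0 : 0 <= b by apply: le_trans (hb 0%N 0 _ _); [exact: normr_ge0|lra|lra].
pose f n x := (w x * h n x * h n x)%:E.
have mf n : @measurable_fun _ _ (measurableTypeR R) _ (@I R) (f n).
  by apply/measurable_EFinP; do 2!apply: measurable_funM => //.
have fb n x : -1 < x -> x < 1 -> 0 <= w x * h n x * h n x <= b * `|h n x|.
  move=> x1 x2; have /andP[wx0 wx1] := w01 x x1 x2.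
  have hx := hb n x x1 x2; have h0 := normr_ge0 (h n x).
  rewrite -mulrA -expr2 -real_normK ?num_real // mulr_ge0 ?sqr_ge0 //=.
  set y := `|_| in hx h0 *; have y2 : y ^+ 2 <= b * y by rewrite expr2 ler_wpM2r.
  by have := sqr_ge0 y; nra.
have ig : mu.-integrable (@I R) (EFin \o (fun=> b ^+ 2)).
  by apply: (integ_bounded _ _ `|b ^+ 2|) => //; exact: measurable_cst.
have fg n x : (@I R) x -> (`|f n x| <= (EFin \o (fun=> (b ^+ 2)%R)) x)%E.
  move=> /inI [x1 x2]; rewrite /= lee_fin; have /andP[f0 f1] := fb n x x1 x2.
  by rewrite (ger0_norm f0) (le_trans f1) // expr2 ler_wpM2l // hb.
have ff x : (@I R) x -> f ^~ x @ \oo --> (cst 0%E : R -> \bar R) x.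
  move=> /inI [x1 x2]; apply: cvg_EFin; first by near=> n.
  apply/cvgrPdist_le => e e0; near=> n; rewrite /= sub0r normrN.
  have /andP[f0 f1] := fb n x x1 x2; rewrite (ger0_norm f0); apply: (le_trans f1).
  have c0 : 0 < 1 - x ^+ 2 by nra.
  have n0 : b ^+ 2 / (e * (1 - x ^+ 2)) <= n%:R by near: n; exact: nbhs_infty_ger.
  have n1 : 1 <= n%:R :> R by near: n; exact: nbhs_infty_ger.
  move: n0; rewrite ler_pdivrMr ?mulr_gt0 // => n0.
  have := hd n x x1 x2; set y := `|_|; set c := 1 - _ in c0 n0 * => hy.
  rewrite -(@ler_pM2l _ (n%:R * c)); last by rewrite mulr_gt0 //; lra.
  have := @ler_wpM2l _ b b0 _ _ hy; nra.
have := @dominated_cvg _ _ _ mu _ (measurableI R) f (cst 0%E) (EFin \o (fun=> b ^+ 2)) mf ff (fun _ _ => isT) ig fg.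
rewrite integral0 => /fine_cvgP [_ cv].
apply/cvgrPdist_le => e e0; move/cvgrPdist_le : cv => /(_ (e ^+ 2)); rewrite exprn_gt0 //.
move=> /(_ isT); apply: filterS => n /=; rewrite !sub0r !normrN => hn.
rewrite ger0_norm ?nrm_ge0 // -(@ler_pXn2r _ 2) // ?nnegrE ?nrm_ge0 ?(ltW e0) //.
by rewrite nrm_sqr //; apply: le_trans hn; exact: ler_norm.
Unshelve. all: by end_near. Qed.

Lemma test_fun_facts phi : test_fun phi ->
  [/\ continuous phi, continuous (derive1 phi), forall x, is_derive x 1 phi (derive1 phi x),
   phi (-1) = 0 & phi 1 = 0].
Proof.
move=> [d [a [b [a1 [b1 ab]]]]].
have d0 := d 0%N; have d1 := d 1%N; split.
- by move=> x; apply/differentiable_continuous/derivable1_diffP.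
- by move=> x; apply/differentiable_continuous/derivable1_diffP; have := d1 x.
- by move=> x; rewrite derive1E; exact/derivableP.
- by apply: ab; left.
- by apply: ab; right.
Qed.

Lemma test_fun_Wc phi : test_fun phi -> Wc R (derive1 phi).
Proof.
move=> [d _]; have d1 := d 1%N; have d2 := d 2%N.
have c2 : continuous (derive1 (derive1 phi)).
  by move=> x; apply/differentiable_continuous/derivable1_diffP; have := d2 x.
have [||c _ hc] := @EVT_max R (fun x => `|derive1 (derive1 phi) x|) (-1) 1.
- by lra.
- apply: continuous_subspaceT => x; apply: continuous_comp; last exact: norm_continuous.
  exact: c2.
have hd x : is_derive x 1 (derive1 phi) (derive1 (derive1 phi) x).
  by rewrite derive1E; exact: (derivableP (d1 x)).
have hb x : -1 <= x -> x <= 1 -> `|derive1 (derive1 phi) x| <= `|derive1 (derive1 phi) c|.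
  by move=> x1 x2; apply: hc; rewrite in_itv /= x1 x2.
exact: (Wc_deriv _ _ _ _ hd (normr_ge0 _) hb).
Qed.

Lemma in_V_approx u du : in_V u du -> [/\ L2w R one u, L2w R (@omega R) du &
  forall e, 0 < e -> exists phi, [/\ test_fun phi, nrm R one (fun x => phi x - u x) <= e &
     nrm R (@omega R) (fun x => derive1 phi x - du x) <= e]].
Proof.
move=> [mu_ [mdu [phi [tphi]]]] /fine_cvgP[fin cv].
pose F n x := (phi n x - u x) ^+ 2 + omega x * (derive1 (phi n) x - du x) ^+ 2.
have w1 := weight1 R; have wo := weight_omega R.
have m1 n : mfun (fun x => phi n x - u x).
  have [c _ _ _ _] := test_fun_facts _ (tphi n).
  by apply: measurable_funB => //; exact: measurable_continuous.
have m2 n : mfun (fun x => derive1 (phi n) x - du x).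
  have [_ c _ _ _] := test_fun_facts _ (tphi n).
  by apply: measurable_funB => //; exact: measurable_continuous.
have mF n : mfun (F n).
  apply: measurable_funD; first exact: measurable_funX.
  by apply: measurable_funM; [exact: wo.1|exact: measurable_funX].
have wF0 n x : 0 <= omega x * (derive1 (phi n) x - du x) ^+ 2.
  by apply: mulr_ge0; [exact: omega_ge0|exact: sqr_ge0].
have F0 n x : 0 <= F n x by apply: addr_ge0; [exact: sqr_ge0|exact: wF0].
have key e : 0 < e -> exists n, [/\ L2w R one (fun x => phi n x - u x),
    L2w R (@omega R) (fun x => derive1 (phi n) x - du x),
    nrm R one (fun x => phi n x - u x) <= e &
     nrm R (@omega R) (fun x => derive1 (phi n) x - du x) <= e].
  move=> e0; move/cvgrPdist_le : cv => /(_ (e ^+ 2)); rewrite exprn_gt0 // => /(_ isT) cv'.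
  (* The extended integrals are finite only from some rank on, so finiteness and smallness are taken
     at the same n. *)
  have [n [fn]] := @filter_ex _ _ _ _ (filterI fin cv').
  rewrite /= sub0r normrN => hn; exists n.
  have iF : integ R (F n).
    apply/integrableP; split; first exact/measurable_EFinP.
    rewrite (_ : \int[mu]_(x in @I R) _ = \int[mu]_(x in @I R) (F n x)%:E)%E.
      by move: fn; rewrite fin_numE => /andP[_]; rewrite ltey.
    by apply: eq_integral => x _; rewrite /= ger0_norm.
  have i1 : integ R (fun x => 1 * (phi n x - u x) ^+ 2).
    apply: integ_le iF; first by apply: measurable_funM => //; exact: measurable_funX.
    by move=> x x1 x2; rewrite mul1r ger0_norm ?sqr_ge0 // /F lerDl wF0.
  have i2 : integ R (fun x => omega x * (derive1 (phi n) x - du x) ^+ 2).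
    apply: integ_le iF; first by apply: measurable_funM; [exact: wo.1|exact: measurable_funX].
    by move=> x x1 x2; rewrite ger0_norm ?wF0 // /F lerDr sqr_ge0.
  have Fe : intI (F n) <= e ^+ 2 by apply: le_trans hn; exact: ler_norm.
  split => //; rewrite -(@ler_pXn2r _ 2) // ?nnegrE ?nrm_ge0 ?(ltW e0) // nrm_sqr //;
    apply: le_trans Fe; apply: le_intI => //; try exact: integ_ip.
  - by move=> x _ _; rewrite mul1r -expr2 /F lerDl wF0.
  - by move=> x _ _; rewrite -mulrA -expr2 /F lerDr sqr_ge0.
have [n [h1 h2 _ _]] := key 1 ltr01.
have [c1 c2 _ _ _] := test_fun_facts _ (tphi n); split.
- have := L2wB _ _ w1 _ _ (L2w_continuous _ _ w1 c1) h1; apply: eq_L2w => x _ _; ring.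
- have := L2wB _ _ wo _ _ (L2w_continuous _ _ wo c2) h2; apply: eq_L2w => x _ _; ring.
by move=> e e0; have [k [_ _ k1 k2]] := key e e0; exists (phi k).
Qed.

(** Puts V_N inside V, so that the weak equation can be tested with discrete functions. *)
Lemma in_V_poly p : p.[-1] = 0 -> p.[1] = 0 -> in_V (horner p) (horner p^`()).
Proof.
move=> pm p1; have [phi [B B0 [tphi hphi]]] := cutoff_approx R p pm p1.
have w1 := weight1 R; have wo := weight_omega R.
split; first exact: (L2w_poly _ _ p w1).1.
split; first exact: (L2w_poly _ _ p^`() w1).1.
exists phi; split => //.
have c n := test_fun_facts _ (tphi n).
have h1 w n : weight R w -> L2w R w (fun x => phi n x - p.[x]).
  by move=> wP; have [c1 _ _ _ _] := c n; apply: L2wB => //; [exact: L2w_continuous|exact: L2w_poly].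
have h2 w n : weight R w -> L2w R w (fun x => derive1 (phi n) x - p^`().[x]).
  by move=> wP; have [_ c2 _ _ _] := c n; apply: L2wB => //; [exact: L2w_continuous|exact: L2w_poly].
have cv1 : nrm R one (fun x => phi n x - p.[x]) @[n --> \oo] --> 0.
  apply: (nrm_dominated_cvg one (fun n x => phi n x - p.[x]) B) => //.
  - by move=> n; exact: (h1 one n w1).1.
  - by move=> n x x1 x2; case: (hphi n x x1 x2).
  - by move=> n x x1 x2; case: (hphi n x x1 x2).
have cv2 : nrm R (@omega R) (fun x => derive1 (phi n) x - p^`().[x]) @[n --> \oo] --> 0.
  apply: (nrm_dominated_cvg (@omega R) (fun n x => derive1 (phi n) x - p^`().[x]) B) => //.
  - by move=> n; exact: (h2 one n w1).1.
  - by move=> n x x1 x2; case: (hphi n x x1 x2).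
  - by move=> n x x1 x2; case: (hphi n x x1 x2).
pose F n x := (phi n x - p.[x]) ^+ 2 + omega x * (derive1 (phi n) x - p^`().[x]) ^+ 2.
have iF n : integ R (F n).
  have := integD _ _ _ 1 1 (h1 one n w1).2 (h2 _ n wo).2.
  by apply: eq_integ => x _ _; rewrite !mul1r.
apply/fine_cvgP; split.
  by near=> n; apply: integrable_fin_num => //; [exact: measurableI|exact: (iF n)].
have -> : (fine \o (fun n => \int[mu]_(x in @I R) (F n x)%:E)%E) =
   (fun n => nrm R one (fun x => phi n x - p.[x]) * nrm R one (fun x => phi n x - p.[x]) +
     nrm R (@omega R) (fun x => derive1 (phi n) x - p^`().[x]) *
      nrm R (@omega R) (fun x => derive1 (phi n) x - p^`().[x])).
  apply/funext => n; rewrite /= -!expr2 !nrm_sqr //.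
  have := intID _ _ _ 1 1 (integ_ip _ _ w1 _ _ (h1 one n w1) (h1 one n w1))
    (integ_ip _ _ wo _ _ (h2 _ n wo) (h2 _ n wo)); rewrite !mul1r => <-.
  by apply: eq_intI => x _ _; rewrite /F; ring.
rewrite -[X in _ --> X](_ : 0 * 0 + 0 * 0 = 0 :> R); last by rewrite mul0r addr0.
by apply: cvgD; apply: cvgM.
Unshelve. all: by end_near. Qed.

(** The admissible pairs (function, derivative) form a closed set in L^2 x L^2, by Cauchy-Schwarz.
    The approximants need not be test functions, so the lemma can be applied again to its own
    output. *)
Lemma weak_limit u g F f : L2w R one u -> L2w R one g -> L2w R one F -> L2w R one f ->
  (forall e, 0 < e -> exists psi dpsi, [/\ L2w R one psi, L2w R one dpsi,
     ip R one u dpsi = - ip R one g psi,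
     nrm R one (fun x => psi x - F x) <= e & nrm R one (fun x => dpsi x - f x) <= e]) ->
  ip R one u f = - ip R one g F.
Proof.
move=> hu hg hF hf lim; have w1 := weight1 R.
apply/eqP; rewrite -subr_eq0 opprK -normr_eq0; apply/eqP/le_anti/andP; split; last exact: normr_ge0.
apply/ler_addgt0Pl => e e0; rewrite addr0.
set S := nrm R one u + nrm R one g + 1.
have S0 : 0 < S by rewrite ltr_wpDl // addr_ge0 ?nrm_ge0.
have [|psi [dpsi [h1 h2 eq n1 n2]]] := lim (e / S); first by rewrite divr_gt0.
have -> : ip R one u f + ip R one g F =
    - (ip R one u (fun x => dpsi x - f x) + ip R one g (fun x => psi x - F x)).
  rewrite (ipC _ _ u) (ipC _ _ g) (ipC _ _ u (fun x => _)) (ipC _ _ g (fun x => _)).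
  rewrite !ipBl // (ipC _ _ dpsi) (ipC _ _ psi) eq; ring.
rewrite normrN; apply: (le_trans (ler_normD _ _)).
have a1 := ip_le_nrm _ _ w1 _ _ hu (L2wB _ _ w1 _ _ h2 hf).
have a2 := ip_le_nrm _ _ w1 _ _ hg (L2wB _ _ w1 _ _ h1 hF).
have b1 : nrm R one u * nrm R one (fun x => dpsi x - f x) <= nrm R one u * (e / S).
  by rewrite ler_wpM2l // nrm_ge0.
have b2 : nrm R one g * nrm R one (fun x => psi x - F x) <= nrm R one g * (e / S).
  by rewrite ler_wpM2l // nrm_ge0.
have -> : e = nrm R one u * (e / S) + nrm R one g * (e / S) + e / S.
  by rewrite /S; field; rewrite gt_eqF.
have : 0 < e / S by rewrite divr_gt0.
lra.
Qed.

Lemma weak_poly u g p : L2w R one u -> L2w R one g -> weak_deriv g u ->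
  p.[-1] = 0 -> p.[1] = 0 -> ip R one u (horner p^`()) = - ip R one g (horner p).
Proof.
move=> hu hg ug pm p1; have w1 := weight1 R.
have [phi [B B0 [tphi hphi]]] := cutoff_approx R p pm p1.
have c n := test_fun_facts _ (tphi n).
have h1 n : L2w R one (fun x => phi n x - p.[x]).
  by have [c1 _ _ _ _] := c n; apply: L2wB => //; [exact: L2w_continuous|exact: L2w_poly].
have h2 n : L2w R one (fun x => derive1 (phi n) x - p^`().[x]).
  by have [_ c2 _ _ _] := c n; apply: L2wB => //; [exact: L2w_continuous|exact: L2w_poly].
have cv1 : nrm R one (fun x => phi n x - p.[x]) @[n --> \oo] --> 0.
  apply: (nrm_dominated_cvg one (fun n x => phi n x - p.[x]) B) => //.
  - by move=> n; exact: (h1 n).1.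
  - by move=> n x x1 x2; case: (hphi n x x1 x2).
  - by move=> n x x1 x2; case: (hphi n x x1 x2).
have cv2 : nrm R one (fun x => derive1 (phi n) x - p^`().[x]) @[n --> \oo] --> 0.
  apply: (nrm_dominated_cvg one (fun n x => derive1 (phi n) x - p^`().[x]) B) => //.
  - by move=> n; exact: (h2 n).1.
  - by move=> n x x1 x2; case: (hphi n x x1 x2).
  - by move=> n x x1 x2; case: (hphi n x x1 x2).
apply: weak_limit => //; [exact: L2w_poly|exact: L2w_poly|] => e e0.
move/cvgrPdist_le : cv1 => /(_ e e0) cv1; move/cvgrPdist_le : cv2 => /(_ e e0) cv2.
have [n [n1 n2]] := @filter_ex _ _ _ _ (filterI cv1 cv2).
have [c1 c2 _ _ _] := c n; exists (phi n), (derive1 (phi n)); split.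
- exact: L2w_continuous.
- exact: L2w_continuous.
- have := ug _ (tphi n); rewrite /ip => h.
  transitivity (intI (fun x => u x * derive1 (phi n) x)); first by apply: eq_intI => x _ _; ring.
  by rewrite h; congr (- _); apply: eq_intI => x _ _; ring.
- by move: n1; rewrite /= sub0r normrN; apply: le_trans; exact: ler_norm.
- by move: n2; rewrite /= sub0r normrN; apply: le_trans; exact: ler_norm.
Qed.

(** Made for F = [omega Q_k], which is not compactly supported inside I; polynomials vanishing at
    the ends are the intermediate class between it and test functions. *)
Lemma weak_continuous u g F f : L2w R one u -> L2w R one g -> weak_deriv g u ->
  (forall x, -1 < x -> x < 1 -> is_derive x 1 F (f x)) -> continuous F -> continuous f ->
  F (-1) = 0 -> F 1 = 0 -> Wc R f -> ip R one u f = - ip R one g F.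
Proof.
move=> hu hg ug dF cF cf Fm F1 fW; have w1 := weight1 R.
apply: weak_limit => //; [exact: L2w_continuous|exact: L2w_continuous|] => e e0.
have [||P [Pm P1 PF]] := poly_approx_derivable R F f dF _ Fm F1 fW (e / 2).
- exact: continuous_subspaceT.
- lra.
exists (horner P), (horner P^`()); split.
- exact: L2w_poly.
- exact: L2w_poly.
- exact: weak_poly.
- have -> : e = 2 * (e / 2) by field.
  apply: nrm_bounded => //; [lra| |].
    by apply: (L2wB _ _ w1 _ _ _ _).1; [exact: L2w_poly|exact: L2w_continuous].
  by move=> x x1 x2; case: (PF x (ltW x1) (ltW x2)).
- have -> : e = 2 * (e / 2) by field.
  apply: nrm_bounded => //; [lra| |].
    by apply: (L2wB _ _ w1 _ _ _ _).1; [exact: L2w_poly|exact: L2w_continuous].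
  by move=> x x1 x2; case: (PF x (ltW x1) (ltW x2)).
Qed.

End WeakDerivatives.

(** * Expansion in second-kind Chebyshev polynomials and decay of coefficients *)

Section ChebyshevExpansion.
Variable R : realType.
Local Open Scope classical_set_scope.
Local Open Scope ring_scope.
Implicit Types (h g u du f F : R -> R) (i j k m n : nat) (x a b e : R) (p q : {poly R}).
Notation one := (fun=> 1 : R).
Notation om := (@omega R).
Notation U k := (horner (chS R k.+1)).

(** Equals pi/2: the common squared [omega]-norm of all the U_k. *)
Definition Mom : R := intI om.

Let w1 := weight1 R.
Let wo := weight_omega R.

Lemma intI_deriv p : intI (horner p^`()) = p.[1] - p.[-1].
Proof.
have d x : -1 < x -> x < 1 -> is_derive x 1 (horner p) p^`().[x].
  by move=> _ _; exact: is_derive_poly.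
exact: (intI_FTC _ _ _ d (@continuous_horner R p) (@continuous_horner R p^`())).
Qed.

Lemma continuous_omega_mul p : continuous (fun x => omega x * p.[x]).
Proof. by move=> x; apply: cvgM; [exact: omega_continuous|exact: continuous_horner]. Qed.

(** Since 0 <= [omega] <= 1, [omega] dominates its square 1 - x^2, whose integral 4/3 comes from the
    primitive x - x^3/3. *)
Lemma Mom_gt0 : 0 < Mom.
Proof.
have := intI_deriv ('X - 3^-1 *: 'X^3).
rewrite !(hornerD, hornerN, hornerZ, hornerXn, hornerX) => h.
apply: (@lt_le_trans _ _ (intI (horner ('X - 3^-1 *: 'X^3)^`()))); first by rewrite h; lra.
have ic (f : R -> R) : continuous f -> integ R f.
  move=> cf; have L1 : L2w R one one by apply: L2w_continuous => //; exact: cst_continuous.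
  have i1 := integ_ip _ _ w1 _ _ (L2w_continuous _ _ _ w1 cf) L1.
  by apply: (eq_integ _ _ _ _ i1) => x _ _; ring.
apply: le_intI; [exact/ic/continuous_horner|exact/ic/omega_continuous|].
move=> x x1 x2.
have o1 := omega_le1 R x; have o0 := omega_ge0 R x; have o2 := omega_sqr R x (ltW x1) (ltW x2).
have -> : ('X - 3^-1 *: 'X^3)^`().[x] = 1 - x ^+ 2.
  by rewrite derivB derivX derivZ derivXn /= !(hornerD, hornerN, hornerZ, hornerMn, hornerXn, hornerC); field.
by rewrite -o2 expr2 ler_piMl.
Qed.

Let M0 := Mom_gt0.

Lemma int_omega_chS k : intI (fun x => omega x * (chS R k.+2).[x]) = 0.
Proof.
have := intI_FTC _ _ _ (omega_mul_derive _ _ _ (chQ_eq R k))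
  (continuous_omega_mul _) (continuous_omega_mul _).
by rewrite omega1 omegaN1 !mul0r subrr.
Qed.

Lemma L2om p : L2w R om (horner p). Proof. exact: L2w_poly. Qed.

Lemma ipD_poly w h p q a b : weight R w -> L2w R w h ->
  ip R w h (horner (a *: p + b *: q)) = a * ip R w h (horner p) + b * ip R w h (horner q).
Proof.
move=> wP hh; rewrite (ipC _ _ h (horner p)) (ipC _ _ h (horner q)) -ipDl //; try exact: L2w_poly.
by rewrite ipC; apply: eq_ip => // x _ _; rewrite !hornerE.
Qed.

Lemma ip_sum w h (c : nat -> R) (P : nat -> {poly R}) n K : weight R w -> L2w R w h ->
  ip R w h (horner (\sum_(n <= k < K) c k *: P k)) =
  \sum_(n <= k < K) c k * ip R w h (horner (P k)).
Proof.
move=> wP hh; elim: K => [|K IH].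
  rewrite !big_geq //; transitivity (intI (fun=> 0 : R)).
    by apply: eq_intI => x _ _; rewrite horner0 mulr0.
  by rewrite intI_cst mulr0.
have [nK|Kn] := leqP n K; last first.
  rewrite !big_geq //; transitivity (intI (fun=> 0 : R)).
    by apply: eq_intI => x _ _; rewrite horner0 mulr0.
  by rewrite intI_cst mulr0.
rewrite !big_nat_recr //= -IH -[X in X + _]scale1r ipD_poly // mul1r; congr (_ + _).
Qed.

(** By [chS_mulSS] the product U_{j+1} U_{k+1} is U_{j+k+2} + U_j U_k, and the first term has zero
    weighted integral; the descent ends when an index is 0. *)
Lemma chS_ortho j k : ip R om (U j) (U k) = (j == k)%:R * Mom.
Proof.
elim: j k => [|j IH] k.
  transitivity (intI (fun x => omega x * (chS R k.+1).[x])).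
    by apply: eq_intI => x _ _; rewrite chS1 hornerC mulr1.
  case: k => [|k]; last by rewrite int_omega_chS mul0r.
  by rewrite mul1r; apply: eq_intI => x _ _; rewrite chS1 hornerC mulr1.
case: k => [|k].
  rewrite mul0r -[RHS](int_omega_chS j).
  by apply: eq_intI => x _ _; rewrite chS1 hornerC mulr1.
rewrite eqSS -IH.
have -> : ip R om (U j.+1) (U k.+1) = ip R om one (U (j.+1 + k.+1)) + ip R om (U j) (U k).
  have L1 : L2w R om one by apply: L2w_continuous => //; exact: cst_continuous.
  rewrite -[ip _ _ one _]mul1r -[ip _ _ (U j) _]mul1r /ip -intID; try exact: integ_ip (L2om _).
    by apply: eq_intI => x _ _; rewrite -mulrA -hornerM chS_mulSS hornerD hornerM; ring.
  by apply: integ_ip => //; exact: L2om.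
rewrite addSn; have := int_omega_chS (j + k.+1); rewrite /ip => h.
by rewrite -[RHS]add0r -[in RHS]h; congr (_ + _); apply: eq_intI => x _ _; ring.
Qed.

Definition cf h (k : nat) : R := ip R om h (U k) / Mom.

Lemma cfE h k : ip R om h (U k) = cf h k * Mom.
Proof. by rewrite /cf divfK // gt_eqF. Qed.

Definition Usum (c : nat -> R) n K : {poly R} := \sum_(n <= k < K) c k *: chS R k.+1.

Lemma ip_Usum h c n K : L2w R om h ->
  ip R om h (horner (Usum c n K)) = Mom * \sum_(n <= k < K) c k * cf h k.
Proof.
move=> hh; rewrite ip_sum // big_distrr /=; apply: eq_bigr => k _.
by rewrite cfE; ring.
Qed.

Lemma cf_Usum c n K k : cf (horner (Usum c n K)) k = if (n <= k < K)%N then c k else 0.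
Proof.
rewrite /cf ipC ip_sum //; last exact: L2om.
have -> : \sum_(n <= j < K) c j * ip R om (U k) (U j) =
   \sum_(n <= j < K) (if k == j then c k * Mom else 0).
  by apply: eq_bigr => j _; rewrite chS_ortho; case: eqP => [->|_]; rewrite ?mul1r // mul0r mulr0.
case: ifP => nkK.
  rewrite (bigD1_seq k) ?mem_index_iota ?iota_uniq //= eqxx big1 ?addr0 ?mulfK ?gt_eqF //.
  by move=> i; rewrite eq_sym => /negbTE ->.
rewrite big1_seq ?mul0r // => i /andP[_]; rewrite mem_index_iota.
by case: eqP => // <-; rewrite nkK.
Qed.

Lemma nrm_Usum c n K : nrm R om (horner (Usum c n K)) ^+ 2 = Mom * \sum_(n <= k < K) c k ^+ 2.
Proof.
rewrite nrm_sqr // ip_Usum; last exact: L2om.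
congr (_ * _); rewrite !big_nat; apply: eq_bigr => k nk.
by rewrite cf_Usum nk expr2.
Qed.

Lemma bessel h K : L2w R om h -> Mom * \sum_(0 <= k < K) cf h k ^+ 2 <= ip R om h h.
Proof.
move=> hh; set s := horner (Usum (cf h) 0 K).
have hs : L2w R om s by exact: L2om.
have := ip_ge0 R om wo (fun x => h x - s x).
rewrite ipBl //; last by exact: L2wB.
rewrite (ipC _ _ h) (ipC _ _ s) !ipBl // (ipC _ _ s h) -(nrm_sqr _ _ wo s) nrm_Usum.
rewrite ip_Usum //.
have -> : \sum_(0 <= k < K) cf h k * cf h k = \sum_(0 <= k < K) cf h k ^+ 2 by [].
lra.
Qed.

Lemma L2om_of h : L2w R one h -> L2w R om h. Proof. exact: L2w_omega. Qed.

(* Integrating [omega U_k] by parts against a weak derivative. *)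
Lemma cf_weak u g k : L2w R one u -> L2w R one g -> weak_deriv g u ->
  cf u k.+1 = 2^-1 * (cf g k / k.+1%:R - cf g k.+2 / k.+3%:R).
Proof.
move=> hu hg ug.
have := weak_continuous R u g (fun x => omega x * (chQ R k).[x])
  (fun x => omega x * (chS R k.+2).[x]) hu hg ug (omega_mul_derive _ _ _ (chQ_eq R k))
  (continuous_omega_mul _) (continuous_omega_mul _).
rewrite omegaN1 omega1 !mul0r => /(_ erefl erefl (WcM _ _ _ (Wc_omega R) (Wc_poly R _))) h.
have e1 : ip R om u (U k.+1) = ip R one u (fun x => omega x * (chS R k.+2).[x]).
  by apply: eq_intI => x _ _; ring.
have e2 : ip R one g (fun x => omega x * (chQ R k).[x]) = ip R om g (horner (chQ R k)).
  by apply: eq_intI => x _ _; ring.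
rewrite /cf e1 h e2 /chQ.
have -> : 2^-1 *: (k.+3%:R^-1 *: chS R k.+3 - k.+1%:R^-1 *: chS R k.+1) =
   (2^-1 / k.+3%:R) *: chS R k.+3 + (- (2^-1 / k.+1%:R)) *: chS R k.+1.
  by rewrite scalerBr !scalerA scaleNr.
rewrite ipD_poly //; last exact: L2om_of.
field; have k0 := ler0n R k; apply/and3P; split; rewrite gt_eqF //; clear -k0; lra.
Qed.

Lemma coef_decay i : exists2 C : R, 0 <= C & forall (b : nat -> nat -> R) (H : R), 0 <= H ->
  (forall l, (l <= i)%N -> forall K, \sum_(0 <= k < K) b l k ^+ 2 <= H) ->
  (forall l, (l < i)%N -> forall k, b l k.+1 = 2^-1 * (b l.+1 k / k.+1%:R - b l.+1 k.+2 / k.+3%:R)) ->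
  forall n K, \sum_(n <= k < K) b 0%N k ^+ 2 <= C * H / n.+1%:R ^+ i.*2.
Proof.
elim: i => [|i [C C0 IH]].
  exists 1 => // b H H0 hb _ n K; rewrite expr0 divr1 mul1r; apply: le_trans (hb 0%N isT K).
  have [nK|Kn] := leqP n K; last first.
    by rewrite big_geq ?(ltnW Kn) //; apply: sumr_ge0 => k _; exact: sqr_ge0.
  rewrite (@big_cat_nat _ _ _ n 0 K) //= lerDr; apply: sumr_ge0 => k _; exact: sqr_ge0.
(* The power of 4 pays for n+2 <= 2(n+1), raised to 2(i+1), when the index shifts; the summand 1
   covers n = 0, as the recursion says nothing about [b 0 0]. *)
exists (C * 4 ^+ i.+1 + 1); first by rewrite addr_ge0 // mulr_ge0 // exprn_ge0.
move=> b H H0 hb rec n K.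
have IH' := IH (fun l => b l.+1) H H0 (fun l li => hb l.+1 li) (fun l li => rec l.+1 li).
have sq0 (c : nat -> R) m L : 0 <= \sum_(m <= k < L) c k ^+ 2.
  by apply: sumr_ge0 => k _; exact: sqr_ge0.
case: n => [|n].
  rewrite expr1n divr1; apply: (le_trans (hb 0%N isT K)); rewrite mulrDl mul1r lerDr.
  by rewrite !mulr_ge0 // exprn_ge0.
case: K => [|K].
  by rewrite big_geq // divr_ge0 ?exprn_ge0 // mulr_ge0 // addr_ge0 // mulr_ge0 // exprn_ge0.
rewrite big_add1 /=.
have n0 : 0 < n.+1%:R :> R by rewrite ltr0n.
set X := C * H / n.+1%:R ^+ i.*2 in IH' *.
have X0 : 0 <= X by rewrite divr_ge0 ?exprn_ge0 // mulr_ge0.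
apply: (@le_trans _ _ (\sum_(n <= k < K) (n.+1%:R ^- 2 * (2^-1 * b 1%N k ^+ 2 + 2^-1 * b 1%N k.+2 ^+ 2)))).
  rewrite big_nat [leRHS]big_nat; apply: ler_sum => k /andP[nk _].
  rewrite rec // [leRHS]mulrC ler_pdivlMr ?exprn_gt0 //.
  set y := b 1%N k; set z := b 1%N k.+2.
  have k1 : (n.+1%:R : R) <= k.+1%:R by rewrite ler_nat.
  have k3 : (n.+1%:R : R) <= k.+3%:R by rewrite ler_nat; lia.
  have r (t c : R) : n.+1%:R <= c -> (t / c * n.+1%:R) ^+ 2 <= t ^+ 2.
    move=> nc; have c0 : 0 < c by exact: lt_le_trans nc.
    rewrite (_ : t / c * n.+1%:R = t * (n.+1%:R / c)); last by field; rewrite gt_eqF.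
    rewrite exprMn ler_piMr ?sqr_ge0 // expr_le1 // ?divr_ge0 ?(ltW c0) //.
    by rewrite ler_pdivrMr // mul1r.
  have ry := r y _ k1; have rz := r z _ k3.
  have := sqr_ge0 (y / k.+1%:R * n.+1%:R + z / k.+3%:R * n.+1%:R).
  set p := y / _ in ry *; set q := z / _ in rz *; set m := n.+1%:R in ry rz *.
  nra.
rewrite -big_distrr /= big_split /= -!big_distrr /=.
have h1 : \sum_(n <= k < K) b 1%N k ^+ 2 <= X := IH' n K.
have h2 : \sum_(n <= k < K) b 1%N k.+2 ^+ 2 <= X.
  apply: le_trans (IH' n K.+2).
  have -> : \sum_(n <= k < K) b 1%N k.+2 ^+ 2 = \sum_(n.+2 <= k < K.+2) b 1%N k ^+ 2.
    by rewrite !big_add1.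
  have [nK|Kn] := leqP n.+2 K.+2; last by rewrite big_geq ?(ltnW Kn).
  by rewrite (@big_cat_nat _ _ _ n.+2 n K.+2) //= ?lerDr //; lia.
apply: (@le_trans _ _ (n.+1%:R ^- 2 * X)).
  by rewrite ler_wpM2l ?invr_ge0 ?exprn_ge0 //; lra.
apply: (@le_trans _ _ (C * 4 ^+ i.+1 * H / n.+2%:R ^+ i.+1.*2)); last first.
  rewrite ler_wpM2r ?invr_ge0 ?exprn_ge0 // mulrDl mul1r lerDl //.
have n2 : 0 < n.+2%:R :> R by rewrite ltr0n.
have -> : n.+1%:R ^- 2 * X = C * H / n.+1%:R ^+ i.+1.*2.
  by rewrite /X doubleS -[in RHS]addn2 exprD [in RHS]invfM; ring.
have -> : C * 4 ^+ i.+1 * H / n.+2%:R ^+ i.+1.*2 = C * H * (4 ^+ i.+1 / n.+2%:R ^+ i.+1.*2) by ring.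
apply: ler_wpM2l; first by rewrite mulr_ge0.
rewrite ler_pdivlMr ?exprn_gt0 // mulrC ler_pdivrMr ?exprn_gt0 //.
have -> : (4 : R) = 2 ^+ 2 by ring.
rewrite -exprM mul2n -exprMn; apply: lerXn2r; rewrite ?nnegrE ?mulr_ge0 //.
by rewrite -natrM ler_nat; lia.
Qed.

Lemma cauchy_schwarz_sum (c d : nat -> R) n K :
  (\sum_(n <= k < K) c k * d k) ^+ 2 <= (\sum_(n <= k < K) c k ^+ 2) * (\sum_(n <= k < K) d k ^+ 2).
Proof.
elim: K => [|K IH]; first by rewrite !big_geq // expr0n /= mul0r.
have [nK|Kn] := leqP n K; last by rewrite !big_geq // expr0n /= mul0r.
rewrite !big_nat_recr //=.
have C0 : 0 <= \sum_(n <= k < K) c k ^+ 2 by apply: sumr_ge0 => k _; exact: sqr_ge0.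
have D0 : 0 <= \sum_(n <= k < K) d k ^+ 2 by apply: sumr_ge0 => k _; exact: sqr_ge0.
set A := \sum_(_ <= _ < _) _ * _ in IH *; set C := \sum_(_ <= _ < _) c _ ^+ 2 in IH C0 *.
set D := \sum_(_ <= _ < _) _ in IH D0 *; set x := c K; set y := d K.
suff : 2 * (A * (x * y)) <= C * y ^+ 2 + D * x ^+ 2 by nra.
have X0 : 0 <= C * y ^+ 2 + D * x ^+ 2 by rewrite addr_ge0 // mulr_ge0 // sqr_ge0.
apply: (le_trans (ler_norm _)); rewrite -(@ler_pXn2r _ 2) // ?nnegrE //.
rewrite real_normK ?num_real //.
apply: (@le_trans _ _ (4 * (C * D) * (x * y) ^+ 2)).
  have -> : (2 * (A * (x * y))) ^+ 2 = 4 * A ^+ 2 * (x * y) ^+ 2 by ring.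
  by rewrite ler_wpM2r ?sqr_ge0 //; lra.
have := sqr_ge0 (C * y ^+ 2 - D * x ^+ 2); nra.
Qed.

Lemma sum_inv_sqr n K : \sum_(n <= k < K) (k.+1%:R : R) ^- 2 <= 2.
Proof.
have H L : \sum_(0 <= k < L.+1) (k.+1%:R : R) ^- 2 <= 2 - L.+1%:R^-1.
  elim: L => [|L IH]; first by rewrite big_nat1 expr1n invr1; lra.
  rewrite big_nat_recr //=; apply: (le_trans (lerD IH (lexx _))).
  have l0 : 0 < L.+1%:R :> R by rewrite ltr0n.
  rewrite -[L.+2%:R]natr1; set l := L.+1%:R in l0 *.
  rewrite -subr_ge0.
  have -> : 2 - (l + 1)^-1 - (2 - l^-1 + (l + 1) ^- 2) = (l * (l + 1) ^+ 2)^-1.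
    by field; apply/andP; split; rewrite gt_eqF //; lra.
  by rewrite invr_ge0 mulr_ge0 ?exprn_ge0 //; lra.
have s0 m L : 0 <= \sum_(m <= k < L) (k.+1%:R : R) ^- 2.
  by apply: sumr_ge0 => k _; rewrite invr_ge0 exprn_ge0.
have [nK|Kn] := leqP n K; last by rewrite big_geq // ltnW.
apply: (@le_trans _ _ (\sum_(0 <= k < K) (k.+1%:R : R) ^- 2)).
  by rewrite (@big_cat_nat _ _ _ n 0 K) //= lerDr.
case: K {nK} => [|K]; first by rewrite big_geq.
by apply: (le_trans (H K)); rewrite gerDl oppr_le0 invr_ge0.
Qed.

End ChebyshevExpansion.

(** * Estimates for primitives: sup norm, L^2 norm and end-point values *)

Section PrimitiveEstimates.
Variable R : realType.
Local Open Scope classical_set_scope.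
Local Open Scope ring_scope.
Implicit Types (i j k m n : nat) (x a b e : R) (p q : {poly R}).
Notation one := (fun=> 1 : R).
Notation om := (@omega R).

Let w1 := weight1 R.
Let wo := weight_omega R.
Let M0 := Mom_gt0 R.

Lemma poly_eq_deriv p q : p^`() = q^`() -> p.[-1] = q.[-1] -> p = q.
Proof.
move=> d v; apply/eqP; rewrite -subr_eq0; set r := p - q.
have dr : r^`() = 0 by rewrite derivB d subrr.
have /size1_polyC rE : (size r <= 1)%N.
  apply/leq_sizeP => -[//|j] _; have := congr1 (fun s : {poly R} => s`_j) dr.
  by rewrite coef_deriv coef0 => /eqP; rewrite mulrn_eq0 => /eqP.
have : r.[-1] = 0 by rewrite hornerD hornerN v subrr.
by rewrite rE hornerC => ->; rewrite polyC0.
Qed.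

(** The primitive of [Usum c n K] that vanishes at -1, because T_{k+1}' = (k+1) U_k and T_{k+1}(-1)
    = (-1)^{k+1}. *)
Definition Tsum (c : nat -> R) n K : {poly R} :=
  \sum_(n <= k < K) (c k / k.+1%:R) *: (chT R k.+1 - ((-1) ^+ k.+1)%:P).

Lemma deriv_Tsum c n K : (Tsum c n K)^`() = Usum R c n K.
Proof.
rewrite /Tsum /Usum raddf_sum; apply: eq_bigr => k _ /=.
by rewrite derivZ derivB derivC subr0 deriv_chT mul_polyC scalerA divfK // pnatr_eq0.
Qed.

Lemma Tsum_N1 c n K : (Tsum c n K).[-1] = 0.
Proof.
rewrite /Tsum horner_sum big1 // => k _.
by rewrite hornerZ hornerD hornerN hornerC horner_chTN1 subrr mulr0.
Qed.

Lemma Tsum_cat c n m K : (n <= m <= K)%N -> Tsum c n K = Tsum c n m + Tsum c m K.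
Proof. by move=> /andP[nm mK]; rewrite /Tsum (@big_cat_nat _ _ _ m n K). Qed.

Lemma deriv_span p N : (size p <= N.+1)%N -> p.[-1] = 0 ->
  exists c : nat -> R, p = Tsum c 0 N.
Proof.
move=> sp p0; have sd : (size p^`() <= N)%N.
  have [->|pn0] := eqVneq p 0; first by rewrite deriv0 size_poly0.
  by have := lt_size_deriv pn0 => h; rewrite -ltnS (leq_trans h).
have [c hc] := @chS_span R N p^`() sd; exists c; apply: poly_eq_deriv.
  by rewrite deriv_Tsum hc /Usum big_mkord.
by rewrite Tsum_N1.
Qed.

(** In [poincare_sup], 8 = 4 * 2: the square of |T_{k+1}(x) - T_{k+1}(-1)| is at most 4, and the sum
    of 1/(k+1)^2 is at most 2. Dividing by [Mom] turns coefficients into the energy norm. *)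
Definition cP : R := Num.sqrt (8 / Mom R).

Lemma cP_ge0 : 0 <= cP. Proof. exact: sqrtr_ge0. Qed.

Lemma poincare_sup p x : p.[-1] = 0 -> -1 <= x -> x <= 1 ->
  `|p.[x]| <= cP * nrm R om (horner p^`()).
Proof.
move=> p0 x1 x2.
have [c hc] := deriv_span p (size p) (leqnSn _) p0.
set N := size p in hc; rewrite {1}hc; rewrite [in X in _ <= X]hc deriv_Tsum.
rewrite -(@ler_pXn2r _ 2) // ?nnegrE ?mulr_ge0 ?cP_ge0 ?nrm_ge0 //.
rewrite real_normK ?num_real // exprMn nrm_Usum sqr_sqrtr ?divr_ge0 ?(ltW M0) //.
have -> : 8 / Mom R * (Mom R * \sum_(0 <= k < N) c k ^+ 2) = (\sum_(0 <= k < N) c k ^+ 2) * 8.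
  by field; rewrite gt_eqF.
rewrite /Tsum horner_sum.
have -> : \sum_(0 <= k < N) ((c k / k.+1%:R) *: (chT R k.+1 - ((-1) ^+ k.+1)%:P)).[x] =
   \sum_(0 <= k < N) c k * (k.+1%:R^-1 * ((chT R k.+1).[x] - (-1) ^+ k.+1)).
  by apply: eq_bigr => k _; rewrite hornerZ hornerD hornerN hornerC mulrA.
apply: (le_trans (cauchy_schwarz_sum _ _ _ _ _)).
apply: ler_wpM2l; first by apply: sumr_ge0 => k _; exact: sqr_ge0.
apply: (@le_trans _ _ (\sum_(0 <= k < N) 4 * (k.+1%:R : R) ^- 2)).
  apply: ler_sum => k _; rewrite exprMn exprVn mulrC ler_wpM2r ?invr_ge0 ?exprn_ge0 //.
  have h1 := chT_le1 R k.+1 x x1 x2.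
  have h2 : `|(-1) ^+ k.+1 : R| <= 1 by rewrite normrX normrN1 expr1n.
  have h := ler_normB (chT R k.+1).[x] ((-1) ^+ k.+1).
  rewrite -[leLHS]real_normK ?num_real //.
  have -> : (4 : R) = 2 ^+ 2 by ring.
  by rewrite lerXn2r ?nnegrE //; lra.
by rewrite -big_distrr /=; have := sum_inv_sqr R 0 N; lra.
Qed.

Lemma poincare p : p.[-1] = 0 -> nrm R one (horner p) <= 2 * (cP * nrm R om (horner p^`())).
Proof.
move=> p0; apply: nrm_bounded => //.
- by rewrite mulr_ge0 ?cP_ge0 ?nrm_ge0.
- by have [] := L2w_poly R one p w1.
- by move=> x x1 x2; apply: poincare_sup => //; exact: ltW.
Qed.

(** A telescoping majorant for the integral of T_n, whose absolute value is 0 for odd n and 2/|n^2 -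
    1| for even n; the constant 8 gives equality at n = 2. *)
Definition beta n : R := 8 / (n.+1%:R * n.+2%:R).

Lemma beta_ge0 n : 0 <= beta n. Proof. by rewrite divr_ge0 // mulr_ge0. Qed.

Lemma betaE n : beta n = 8 / n.+1%:R - 8 / n.+2%:R.
Proof.
rewrite /beta -[n.+2%:R]natr1; have : (0 : R) < n.+1%:R by rewrite ltr0n.
by set c := n.+1%:R => c0; field; apply/andP; split; rewrite gt_eqF //; lra.
Qed.

Lemma intI_chT n : `|intI (horner (chT R n))| <= beta n.
Proof.
case: n => [|[|n]].
- have -> : chT R 0 = ('X)^`() by rewrite derivX.
  rewrite intI_deriv !hornerX /beta ger0_norm; lra.
- have -> : chT R 1 = (2^-1 *: 'X^2)^`().
    by rewrite chT1 derivZ derivXn /= expr1 -(scaler_nat 2 ('X : {poly R})) scalerA mulVf ?scale1r // pnatr_eq0.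
  by rewrite intI_deriv !hornerZ !hornerXn sqrrN subrr normr0 beta_ge0.
have -> : chT R n.+2 = (2^-1 *: (n.+3%:R^-1 *: chT R n.+3 - n.+1%:R^-1 *: chT R n.+1))^`().
  rewrite derivZ derivB !derivZ !deriv_chT !mul_polyC !scalerA !mulVf ?pnatr_eq0 // !scale1r.
  by rewrite -chT_chS -(scaler_nat 2 (chT R n.+2)) scalerA mulVf ?scale1r // pnatr_eq0.
rewrite intI_deriv !hornerZ !hornerD !hornerN !hornerZ !horner_chT1 !horner_chTN1.
rewrite /beta -[n.+4%:R]natr1 -[n.+3%:R]natr1 -[n.+2%:R]natr1.
have n0 : (1 : R) <= n.+1%:R by rewrite ler1n.
rewrite !exprS; set s := (-1) ^+ n; set c := n.+1%:R in n0 *.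
have s1 : `|s| = 1 by rewrite /s normrX normrN1 expr1n.
have -> : 2^-1 * ((c + 1 + 1)^-1 * 1 - c^-1 * 1) -
   2^-1 * ((c + 1 + 1)^-1 * (-1 * (-1 * (-1 * s))) - c^-1 * (-1 * s)) =
   - ((1 + s) / (c * (c + 1 + 1))).
  by field; apply/andP; split; rewrite gt_eqF //; lra.
rewrite normrN normrM normfV (ger0_norm (_ : 0 <= c * (c + 1 + 1))); last by rewrite mulr_ge0 //; lra.
have h : `|1 + s| <= 2 by apply: (le_trans (ler_normD _ _)); rewrite s1 normr1; lra.
rewrite ler_pdivrMr; last by rewrite mulr_gt0 //; lra.
apply: (le_trans h).
have -> : 8 / ((c + 1 + 1) * (c + 1 + 1 + 1)) * (c * (c + 1 + 1)) = 8 * c / (c + 1 + 1 + 1).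
  by field; apply/andP; split; rewrite gt_eqF //; lra.
by rewrite ler_pdivlMr; lra.
Qed.

Definition tau j k : R := ip R one (horner (chT R j.+1)) (horner (chT R k.+1)).

Lemma tau_le m n : `|tau (m + n) n| <= 2^-1 * (beta (m + n + n).+2 + beta m).
Proof.
have -> : tau (m + n) n = 2^-1 * (intI (horner (chT R (m + n + n).+2)) + intI (horner (chT R m))).
  have := intID R (horner (chT R (m + n + n).+2)) (horner (chT R m)) 2^-1 2^-1.
  have ii p : integ R (horner p).
    have L1 : L2w R one one by apply: L2w_continuous => //; exact: cst_continuous.
    have i1 := integ_ip _ _ w1 _ _ (L2w_poly R one p w1) L1.
    by apply: (eq_integ _ _ _ _ i1) => x _ _; ring.
  move=> /(_ (ii _) (ii _)); rewrite mulrDr => <-.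
  apply: eq_intI => x _ _.
  have := congr1 (horner^~ x) (chT_mul R m n.+1); rewrite hornerMn hornerM hornerD !addnS !addSn.
  by rewrite mul1r => h; rewrite -mulrDr -h; field.
rewrite normrM ger0_norm ?invr_ge0 // ler_wpM2l ?invr_ge0 //.
by apply: (le_trans (ler_normD _ _)); apply: lerD; exact: intI_chT.
Qed.

Lemma tauC j k : tau j k = tau k j. Proof. exact: ipC. Qed.

Lemma beta_le m n : (m <= n)%N -> beta n <= beta m.
Proof.
move=> mn; rewrite /beta ler_wpM2l // lef_pV2 ?posrE ?mulr_gt0 ?ltr0n //.
by rewrite ler_pM ?ler_nat.
Qed.

Lemma tau_le_beta m n : `|tau (m + n) n| <= beta m.
Proof.
apply: (le_trans (tau_le m n)).
have : beta (m + n + n).+2 <= beta m by apply: beta_le; lia.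
lra.
Qed.

(** An entry at distance d from the diagonal is at most [beta d], so both half rows telescope: at
    most 4 before the diagonal and 8 from it on. *)
Lemma tau_sum j K : \sum_(0 <= k < K) `|tau j k| <= 16.
Proof.
have lo L d : \sum_(0 <= k < L) `|tau (d + L) k| <= 8 / d.+2%:R.
  elim: L d => [|L IH] d; first by rewrite big_geq // divr_ge0.
  rewrite big_nat_recr //= -addSnnS; apply: (le_trans (lerD (IH d.+1) (tau_le_beta d.+1 L))).
  by rewrite betaE addrC subrK.
have hi L : \sum_(j <= k < j + L) `|tau j k| <= 8 - 8 / L.+1%:R.
  elim: L => [|L IH]; first by rewrite addn0 big_geq // divr1 subrr.
  rewrite addnS big_nat_recr ?leq_addr //=.
  have t := tau_le_beta L j; rewrite tauC addnC in t; apply: (le_trans (lerD IH t)).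
  by rewrite betaE addrA subrK.
have s0 m n : 0 <= \sum_(m <= k < n) `|tau j k| by apply: sumr_ge0 => k _; exact: normr_ge0.
have L0 : \sum_(0 <= k < j) `|tau j k| <= 8 / 2 := lo j 0%N.
have H0 := hi (K - j)%N; have : 0 <= 8 / (K - j).+1%:R :> R by rewrite divr_ge0.
set z := 8 / _ in H0 * => z0.
have [Kj|jK] := leqP K j.
  apply: (@le_trans _ _ (\sum_(0 <= k < j) `|tau j k|)); last by lra.
  by rewrite (@big_cat_nat _ _ _ K 0 j) //= lerDl.
rewrite subnKC ?(ltnW jK) // in H0.
by rewrite (@big_cat_nat _ _ _ j 0 K) ?(ltnW jK) //=; lra.
Qed.

(* Schur's test for the Gram matrix [tau]. *)
Lemma nrm_chT_sum (c : nat -> R) n K :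
  nrm R one (horner (\sum_(n <= k < K) c k *: chT R k.+1)) ^+ 2 <= 16 * \sum_(n <= k < K) c k ^+ 2.
Proof.
set P := horner _; have hP : L2w R one P by exact: L2w_poly.
rewrite nrm_sqr // {2}/P ip_sum //.
have -> : \sum_(n <= k < K) c k * ip R one P (horner (chT R k.+1)) =
   \sum_(n <= k < K) \sum_(n <= j < K) c k * c j * tau k j.
  apply: eq_bigr => k _; rewrite ipC ip_sum //; last exact: L2w_poly.
  by rewrite big_distrr /=; apply: eq_bigr => j _; rewrite mulrA.
apply: (@le_trans _ _ (\sum_(n <= k < K) \sum_(n <= j < K)
    (2^-1 * (c k ^+ 2 * `|tau k j|) + 2^-1 * (c j ^+ 2 * `|tau j k|)))).
  apply: ler_sum => k _; apply: ler_sum => j _; rewrite (tauC j).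
  apply: (le_trans (ler_norm _)); rewrite normrM; have t0 := normr_ge0 (tau k j).
  set t := `|tau k j| in t0 *; rewrite normrM.
  have h : `|c k| * `|c j| <= 2^-1 * c k ^+ 2 + 2^-1 * c j ^+ 2.
    rewrite -(@real_normK _ (c k)) ?num_real // -(@real_normK _ (c j)) ?num_real //.
    have := sqr_ge0 (`|c k| - `|c j|); nra.
  have := ler_wpM2r t0 h; lra.
under eq_bigr do rewrite big_split /=.
rewrite big_split /= [X in _ + X]exchange_big /= -mulr2n.
rewrite (_ : 16 * _ = (8 * \sum_(n <= k < K) c k ^+ 2) *+ 2); last by rewrite mulr2n; lra.
rewrite lerMn2r /= big_distrr /=; apply: ler_sum => k _.
rewrite -!big_distrr /=.
have h : \sum_(n <= j < K) `|tau k j| <= 16.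
  apply: le_trans (tau_sum k K).
  have [nK|Kn] := leqP n K.
    rewrite [leRHS](@big_cat_nat _ _ _ n 0 K) //= lerDr; apply: sumr_ge0 => j _; exact: normr_ge0.
  by rewrite big_geq ?(ltnW Kn) //; apply: sumr_ge0 => j _; exact: normr_ge0.
have := ler_wpM2l (sqr_ge0 (c k)) h; lra.
Qed.

(* The recursion telescopes up to terms of order [k ^ -3]. *)
Lemma tail_sum_bound (a b : nat -> R) (s B : R) n : s ^+ 2 = 1 ->
  (forall k, a k.+1 = 2^-1 * (b k / k.+1%:R - b k.+2 / k.+3%:R)) ->
  (forall k, (n <= k)%N -> `|b k| <= B) ->
  forall K, `|\sum_(n.+1 <= k < K) a k * s ^+ k / k.+1%:R| <= 3 * B / n.+1%:R ^+ 2.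
Proof.
move=> s2 rec bB K.
have B0 : 0 <= B by apply: le_trans (bB n (leqnn n)).
have s1 : `|s| = 1.
  by apply/eqP; rewrite -(@eqrXn2 _ 2) // real_normK ?num_real // s2 expr1n.
(* Since s^2 = 1, the summand of index k+1 is (g_k - g_{k+2})/2 - g_{k+2}/(k+2): a difference over
   two steps plus a term of order k^{-3}. The values s = 1 and s = -1 stand for the two end
   points. *)
pose g k := s ^+ k.+1 * b k / (k.+1%:R * k.+2%:R).
have gB k : (n <= k)%N -> `|g k| <= B / (k.+1%:R * k.+2%:R).
  move=> nk; rewrite normrM normrM normrX s1 expr1n mul1r normfV.
  rewrite (ger0_norm (_ : 0 <= k.+1%:R * k.+2%:R)) ?mulr_ge0 //.
  by rewrite ler_wpM2r ?invr_ge0 ?mulr_ge0 // bB.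
have gB' k : (n <= k)%N -> `|g k| <= B / n.+1%:R ^+ 2.
  move=> nk; apply: (le_trans (gB k nk)); rewrite ler_wpM2l //.
  rewrite lef_pV2 ?posrE ?mulr_gt0 ?exprn_gt0 ?ltr0n // expr2.
  by rewrite ler_pM // ler_nat; lia.
have E L : \sum_(n.+1 <= k < n.+1 + L) a k * s ^+ k / k.+1%:R =
   2^-1 * (g n + g n.+1 - g (n + L)%N - g (n + L).+1 -
     2 * \sum_(n.+1 <= k < n.+1 + L) g k.+1 / k.+1%:R).
  elim: L => [|L IH]; first by rewrite !addn0 !big_geq //; ring.
  rewrite !addnS !(big_nat_recr (n.+1 + L)) ?leq_addr //= IH !addSn rec /g.
  rewrite !exprS; set t := s ^+ (n + L).
  have ks : s * (s * (s * t)) = s * t by rewrite mulrA -expr2 s2 mul1r.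
  rewrite ks -[(n + L).+4%:R]natr1 -[(n + L).+3%:R]natr1 -[(n + L).+2%:R]natr1.
  have c0 : (1 : R) <= (n + L).+1%:R by rewrite ler1n.
  set c := (n + L).+1%:R in c0 *.
  field; rewrite ?gt_eqF //=; lra.
have S L : `|\sum_(n.+1 <= k < n.+1 + L) g k.+1 / k.+1%:R| <=
   B * (n.+1%:R ^- 2 - (n + L).+1%:R ^- 2).
  elim: L => [|L IH]; first by rewrite !addn0 big_geq // normr0 subrr mulr0.
  rewrite addnS (big_nat_recr (n.+1 + L)) ?leq_addr //=.
  apply: (le_trans (ler_normD _ _)); apply: (le_trans (lerD IH (lexx _))).
  rewrite normrM normfV (ger0_norm (ler0n _ _)) !addSn.
  have := gB (n + L).+2 ltac:(lia); rewrite -[(n + L).+4%:R]natr1 -[(n + L).+3%:R]natr1 -[(n + L).+2%:R]natr1.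
  have c0 : (1 : R) <= (n + L).+1%:R by rewrite ler1n.
  rewrite addnS -[(n + L).+2%:R]natr1; set c := (n + L).+1%:R in c0 *; move=> h.
  (* The cubic terms are dominated by differences of inverse squares, which telescope in turn. *)
  have : `|g (n + L).+2| / (c + 1) <= B * (c ^- 2 - (c + 1) ^- 2).
    apply: (@le_trans _ _ (B / ((c + 1 + 1) * (c + 1 + 1 + 1)) / (c + 1))).
      by rewrite ler_wpM2r // invr_ge0; lra.
    rewrite -!mulrA ler_wpM2l // -subr_ge0.
    have -> : c ^- 2 - (c + 1) ^- 2 - ((c + 1 + 1) * (c + 1 + 1 + 1))^-1 / (c + 1) =
      ((2 * c + 1) * (c + 2) * (c + 3) - c ^+ 2 * (c + 1)) / (c ^+ 2 * (c + 1) ^+ 2 * (c + 2) * (c + 3)).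
      field; rewrite ?gt_eqF //=; lra.
    apply: divr_ge0; last by rewrite !mulr_ge0 ?exprn_ge0 //; lra.
    have -> : (2 * c + 1) * (c + 2) * (c + 3) - c ^+ 2 * (c + 1) = c * (c * c + 10 * c + 17) + 6 by ring.
    have cc : 0 <= c * c by rewrite mulr_ge0 //; lra.
    by rewrite addr_ge0 // mulr_ge0 //; lra.
  move=> step; rewrite [leRHS](_ : _ = B * (n.+1%:R ^- 2 - c ^- 2) + B * (c ^- 2 - (c + 1) ^- 2)).
    by rewrite lerD2l.
  ring.
have [Kn|nK] := leqP K n.+1.
  by rewrite big_geq // normr0 divr_ge0 ?exprn_ge0 // mulr_ge0.
rewrite -(subnKC (ltnW nK)) E; set L := (K - n.+1)%N.
have i0 : 0 <= B * (n + L).+1%:R ^- 2 by rewrite mulr_ge0 // invr_ge0 exprn_ge0.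
(* With D = B/(n+1)^2, the four boundary values of [g] contribute at most 2D after the factor 1/2,
   and the remaining sum at most D: hence the 3. *)
have := S L; rewrite mulrBr; have := gB' n (leqnn n); have := gB' n.+1 (leqnSn n).
have := gB' (n + L)%N (leq_addr _ _); have := gB' (n + L).+1 (leqW (leq_addr _ _)).
rewrite -[3 * B / _]mulrA; move: i0; set r := B * (n + L).+1%:R ^- 2; set D := B / n.+1%:R ^+ 2.
set Z := \sum_(_ <= _ < _) _; move: (g n) (g n.+1) (g (n + L)%N) (g (n + L).+1) Z r D.
move=> g1 g2 g3 g4 Z r D r0; rewrite !ler_norml.
move=> /andP[a1 a2] /andP[b1 b2] /andP[c1 c2] /andP[d1 d2] /andP[e1 e2].
by apply/andP; split; lra.
Qed.

End PrimitiveEstimates.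

(** * Comparing the derivative in V with the weak derivative *)

Section IdentifyDerivative.
Variable R : realType.
Local Open Scope classical_set_scope.
Local Open Scope ring_scope.
Implicit Types (u du f g : R -> R) (x a b e : R) (p q r : {poly R}).
Notation one := (fun=> 1 : R).
Notation om := (@omega R).

Let w1 := weight1 R.
Let wo := weight_omega R.

Lemma WcV f (c : R) : 0 < c -> (forall x, -1 <= x -> x <= 1 -> c <= f x) -> Wc R f ->
  Wc R (fun x => (f x)^-1).
Proof.
move=> c0 fc fW e e0; have [|C C0 hC] := fW (e * c ^+ 2); first by rewrite mulr_gt0 // exprn_gt0.
have c2 : 0 < c ^+ 2 by rewrite exprn_gt0.
exists (C / c ^+ 2); first by rewrite divr_ge0 // ltW.
move=> x y x1 x2 y1 y2.
have fx := lt_le_trans c0 (fc x x1 x2); have fy := lt_le_trans c0 (fc y y1 y2).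
have -> : (f x)^-1 - (f y)^-1 = (f y - f x) / (f x * f y).
  by field; rewrite !gt_eqF.
rewrite normrM normfV (gtr0_norm (mulr_gt0 fx fy)) ler_pdivrMr ?mulr_gt0 // distrC.
apply: (le_trans (hC x y x1 x2 y1 y2)).
have -> : e * c ^+ 2 + C * (x - y) ^+ 2 = (e + C / c ^+ 2 * (x - y) ^+ 2) * c ^+ 2.
  by field; rewrite gt_eqF.
apply: ler_wpM2l.
  by rewrite addr_ge0 ?(ltW e0) // mulr_ge0 ?sqr_ge0 // divr_ge0 // ltW.
by rewrite expr2 ler_pM ?fc // ltW.
Qed.

(* Polynomials times [omega] are dense: approximate [1 / omega] by
   [1 / sqrt (omega^2 + eta^2)]. *)
Lemma omega_poly_dense p e : 0 < e ->
  exists r, nrm R om (fun x => omega x * r.[x] - p.[x]) <= e.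
Proof.
move=> e0; have [B B0 hB] := @poly_bound R p.
(* Replacing 1/[omega] by 1/[s] costs at most B^2 eta <= e^2/16 in the weighted square, and
   Weierstrass costs another (e/4)^2. The factor 2 for the square of a sum brings the total to
   (e/2)^2. *)
pose eta := e ^+ 2 / (16 * (B ^+ 2 + 1)).
have B1 : 0 < B ^+ 2 + 1 by rewrite ltr_wpDl ?sqr_ge0.
have eta0 : 0 < eta by rewrite divr_gt0 ?exprn_gt0 // mulr_gt0.
pose s x := Num.sqrt (1 + eta ^+ 2 - x ^+ 2).
have arg0 x : -1 <= x -> x <= 1 -> eta ^+ 2 <= 1 + eta ^+ 2 - x ^+ 2 by move=> x1 x2; nra.
have s2 x : -1 <= x -> x <= 1 -> s x ^+ 2 = 1 + eta ^+ 2 - x ^+ 2.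
  by move=> x1 x2; rewrite sqr_sqrtr // (le_trans _ (arg0 x x1 x2)) // sqr_ge0.
have s0 x : 0 <= s x by exact: sqrtr_ge0.
have seta x : -1 <= x -> x <= 1 -> eta <= s x.
  move=> x1 x2; rewrite -(@ler_pXn2r _ 2) // ?nnegrE ?(ltW eta0) //.
  by rewrite s2 // arg0.
have sW : Wc R s.
  apply: Wc_sqrt; first by move=> x x1 x2; apply: le_trans (arg0 x x1 x2); exact: sqr_ge0.
  have -> : (fun x : R => 1 + eta ^+ 2 - x ^+ 2) = horner ((1 + eta ^+ 2)%:P - 'X^2).
    by apply/funext => x; rewrite !(hornerD, hornerN, hornerXn, hornerC).
  exact: Wc_poly.
have [|r hr] := @weierstrass R _ (WcM _ _ _ (Wc_poly R p) (WcV s eta eta0 seta sW)) (e / 4).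
  lra.
exists r; have -> : e = 2 * (e / 2) by field.
apply: nrm_le_pointwise => //.
- by apply: L2w_continuous => // x; apply: cvgB; [exact: continuous_omega_mul|exact: continuous_horner].
- lra.
move=> x /ltW x1 /ltW x2.
have o0 := omega_ge0 R x; have o1 := omega_le1 R x; have o2 := omega_sqr R x x1 x2.
have hs := s2 x x1 x2; have es := seta x x1 x2.
have hrx := hr x x1 x2; have hBx := hB x x1 x2.
set w := omega x in o0 o1 o2 *; set S := s x in hs es hrx.
have S0 : 0 < S by exact: lt_le_trans es.
have wS : w <= S by nra.
have Sw : S - w <= eta by nra.
set rx := r.[x] in hrx *; set px := p.[x] in hrx hBx *.
set A := rx - px / S in hrx; set T := 1 - w / S.
have -> : w * rx - px = w * A - px * T by rewrite /A /T; ring.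
have T0 : 0 <= T by rewrite subr_ge0 ler_pdivrMr // mul1r.
have T1 : T <= 1 by rewrite /T lerBlDr lerDl divr_ge0 // ltW.
have wT : w * T <= eta.
  have -> : w * T = (w / S) * (S - w) by rewrite /T; field; rewrite gt_eqF.
  apply: le_trans Sw; rewrite ler_piMl //; first by rewrite subr_ge0.
  by rewrite ler_pdivrMr // mul1r.
have A2 : A ^+ 2 <= (e / 4) ^+ 2.
  by rewrite -real_normK ?num_real // lerXn2r // ?nnegrE //; lra.
have p2 : px ^+ 2 <= B ^+ 2 by rewrite -real_normK ?num_real // lerXn2r // nnegrE.
have h1 : w * (w * A) ^+ 2 <= (e / 4) ^+ 2.
  apply: le_trans A2; rewrite exprMn mulrA.
  have w3 : w * w ^+ 2 <= 1 by rewrite -exprS; apply: exprn_ile1.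
  by apply: ler_piMl => //; exact: sqr_ge0.
have h2 : w * (px * T) ^+ 2 <= B ^+ 2 * eta.
  have -> : w * (px * T) ^+ 2 = px ^+ 2 * ((w * T) * T) by ring.
  apply: ler_pM => //; rewrite ?sqr_ge0 // ?mulr_ge0 //.
  by apply: le_trans wT; rewrite ler_piMr // mulr_ge0.
have h3 : B ^+ 2 * eta <= e ^+ 2 / 16.
  rewrite /eta mulrA ler_pdivrMr ?mulr_gt0 //.
  have -> : e ^+ 2 / 16 * (16 * (B ^+ 2 + 1)) = e ^+ 2 * (B ^+ 2 + 1) by field.
  by rewrite mulrC ler_wpM2l ?sqr_ge0 // lerDl.
have : w * (w * A - px * T) ^+ 2 <= 2 * (w * (w * A) ^+ 2) + 2 * (w * (px * T) ^+ 2).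
  have := mulr_ge0 o0 (sqr_ge0 (w * A + px * T)); lra.
move=> h; apply: (le_trans h); lra.
Qed.

(** The identity is proved first against functions [omega r], then extended by [omega_poly_dense].
    The detour is forced by the weight: integrating by parts against p itself would move a
    derivative onto [omega]. *)
Lemma weak_deriv_in_V u du g : in_V u du -> L2w R one g -> weak_deriv g u ->
  forall p, ip R om du (horner p) = ip R om g (horner p).
Proof.
move=> uV hg ug p; have [hu hdu app] := in_V_approx R u du uV.
have hgo := L2w_omega R g hg.
have Lor r : L2w R om (fun x => omega x * r.[x]).
  by apply: L2w_continuous => //; exact: continuous_omega_mul.
have step r : ip R om du (fun x => omega x * r.[x]) = ip R om g (fun x => omega x * r.[x]).
  (* [omega * (omega r)] is this polynomial, which vanishes at both ends: [weak_poly] applies to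
     [g], and for [du] parts are integrated on test functions before passing to the limit. *)
  pose G : {poly R} := (1 - 'X^2) * r.
  have GE x : G.[x] = (1 - x ^+ 2) * r.[x].
    by rewrite /G hornerM !(hornerD, hornerN, hornerXn, hornerC).
  have Gm : G.[-1] = 0 by rewrite GE sqrrN expr1n subrr mul0r.
  have G1 : G.[1] = 0 by rewrite GE expr1n subrr mul0r.
  have e1 (k : R -> R) : ip R one k (horner G) = ip R om k (fun x => omega x * r.[x]).
    apply: eq_intI => x x1 x2; rewrite GE -(omega_sqr R x (ltW x1) (ltW x2)); ring.
  rewrite -[RHS]e1 -[RHS]opprK -(weak_poly R u g G hu hg ug Gm G1).
  have testE phi : test_fun phi -> ip R one phi (horner G^`()) =
     - ip R om (derive1 phi) (fun x => omega x * r.[x]).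
    move=> tphi; have [c1 c2 d1 pm p1] := test_fun_facts R phi tphi.
    have dF x : -1 < x -> x < 1 -> is_derive x 1 (phi * horner G)
        (phi x * G^`().[x] + G.[x] * derive1 phi x).
      by move=> _ _; exact: (@is_deriveM _ _ _ _ _ _ _ _ (d1 x) (is_derive_poly G x)).
    have := intI_FTC R (phi * horner G) (fun x => phi x * G^`().[x] + G.[x] * derive1 phi x) dF.
    rewrite -e1 => h; apply/eqP; rewrite -subr_eq0 opprK.
    have h1 : intI (fun x => phi x * G^`().[x] + G.[x] * derive1 phi x) = 0.
      rewrite h.
      - by rewrite !fctE G1 Gm !mulr0 subrr.
      - by move=> x; apply: cvgM; [exact: c1|exact: continuous_horner].
      - move=> x; apply: cvgD; apply: cvgM.
        + exact: c1.
        + exact: continuous_horner.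
        + exact: continuous_horner.
        + exact: c2.
    have := intID R _ _ 1 1 (integ_ip _ _ w1 _ _ (L2w_continuous _ _ _ w1 c1) (L2w_poly _ _ G^`() w1))
      (integ_ip _ _ w1 _ _ (L2w_continuous _ _ _ w1 c2) (L2w_poly _ _ G w1)).
    rewrite !mul1r -/(ip R one phi (horner G^`())) -/(ip R one (derive1 phi) (horner G)) => <-.
    by apply/eqP; rewrite -[RHS]h1; apply: eq_intI => x _ _; ring.
  apply/eqP; rewrite -subr_eq0 opprK -normr_eq0; apply/eqP/le_anti/andP; split; last exact: normr_ge0.
  apply/ler_addgt0Pl => e e0; rewrite addr0.
  set A := nrm R one (horner G^`()); set B := nrm R om (fun x => omega x * r.[x]).
  have A0 : 0 <= A by exact: nrm_ge0.
  have B0 : 0 <= B by exact: nrm_ge0.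
  have [|phi [tphi n1 n2]] := app (e / (A + B + 1)); first by rewrite divr_gt0 //; lra.
  have [c1 c2 _ _ _] := test_fun_facts R phi tphi.
  have hp := L2w_continuous R one phi w1 c1; have hp' := L2w_continuous R om _ wo c2.
  have -> : ip R om du (fun x => omega x * r.[x]) + ip R one u (horner G^`()) =
     - (ip R om (fun x => derive1 phi x - du x) (fun x => omega x * r.[x]) +
        ip R one (fun x => phi x - u x) (horner G^`())).
    rewrite !ipBl //; last exact: L2w_poly.
    rewrite (testE phi tphi); 
    set y1 := ip R om du _; set y2 := ip R om (derive1 phi) _; set y3 := ip R one u _.
    ring.
  rewrite normrN; apply: (le_trans (ler_normD _ _)).
  have m1 := ip_le_nrm R om wo _ _ (L2wB R om wo _ _ hp' hdu) (Lor r).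
  have m2 := ip_le_nrm R one w1 _ _ (L2wB R one w1 _ _ hp hu) (L2w_poly R one G^`() w1).
  rewrite -/B in m1; rewrite -/A in m2.
  set E := e / _ in n1 n2.
  have k1 := ler_wpM2r B0 n2; have k2 := ler_wpM2r A0 n1.
  have Ee : E * (A + B + 1) = e by rewrite /E divfK // gt_eqF //; lra.
  have E0 : 0 <= E by rewrite divr_ge0 ?(ltW e0) //; lra.
  lra.
have hh := L2wB R om wo _ _ hdu hgo.
apply/eqP; rewrite -subr_eq0 -ipBl //; last exact: L2w_poly.
rewrite -normr_eq0; apply/eqP/le_anti/andP; split; last exact: normr_ge0.
apply/ler_addgt0Pl => e e0; rewrite addr0.
set h := (fun x => _) in hh *; set A := nrm R om h.
have A0 : 0 <= A by exact: nrm_ge0.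
have [|r hr] := omega_poly_dense p (e / (A + 1)); first by rewrite divr_gt0 //; lra.
have -> : ip R om h (horner p) = - ip R om h (fun x => omega x * r.[x] - p.[x]).
  have z0 : ip R om h (fun x => omega x * r.[x]) = 0 by rewrite ipBl // step subrr.
  rewrite (ipC _ _ h (fun x => omega x * r.[x] - p.[x])).
  rewrite (ipBl _ _ wo (fun x => omega x * r.[x]) (horner p) h (Lor r) (L2w_poly _ _ _ wo) hh).
  by rewrite (ipC _ _ _ h) z0 sub0r opprK ipC.
rewrite normrN; apply: (le_trans (ip_le_nrm R om wo _ _ hh (L2wB R om wo _ _ (Lor r) (L2w_poly R om p wo)))).
apply: (@le_trans _ _ (A * (e / (A + 1)))); first by rewrite ler_wpM2l.
rewrite mulrA ler_pdivrMr; last by lra.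
lra.
Qed.

End IdentifyDerivative.

(** * Structure of V_N, convergence of the expansion, and the boundary defect *)

Section GalerkinError.
Variable R : realType.
Local Open Scope classical_set_scope.
Local Open Scope ring_scope.
Implicit Types (u du f g : R -> R) (i j k n K N : nat) (x a b e : R) (p q r : {poly R}).
Notation one := (fun=> 1 : R).
Notation om := (@omega R).

Let w1 := weight1 R.
Let wo := weight_omega R.
Let M0 := Mom_gt0 R.

Lemma chebphiE n : chebphi R n = (1 - 'X^2) * (- 2 *: chS R n.+1).
Proof.
rewrite /chebphi !chebTE -[LHS]opprK opprB chTB scaleNr mulrN -mul_polyC.
by congr (- _); rewrite polyCD; ring.
Qed.

Lemma size_oneBX2 : size (1 - 'X^2 : {poly R}) = 3%N.
Proof. by rewrite -opprB size_polyN size_XnsubC. Qed.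

(** [chebphi n] is -2(1 - x^2) U_n, so V_N is 1 - x^2 times the span of U_0, ..., U_{N-2}, that is,
    times all polynomials of degree at most N-2. *)
Lemma in_VNP N p : (0 < N)%N ->
  in_VN N p <-> [/\ (size p <= N.+1)%N, p.[-1] = 0 & p.[1] = 0].
Proof.
case: N => // N _; split.
  move=> [c ->] /=.
  have -> : \sum_(n < N) c n *: chebphi R n = (1 - 'X^2) * \sum_(n < N) (c n * - 2) *: chS R n.+1.
    rewrite big_distrr /=; apply: eq_bigr => k _.
    by rewrite chebphiE -scalerA -!scalerAr.
  split.
  - apply: (leq_trans (size_polyMleq _ _)); rewrite size_oneBX2 /=.
    rewrite !addSn add0n !ltnS; apply: (leq_trans (size_sum _ _ _)); apply/bigmax_leqP => k _.
    by apply: (leq_trans (size_scale_leq _ _)); rewrite size_chS.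
  - by rewrite hornerM !(hornerD, hornerN, hornerXn, hornerC) sqrrN expr1n subrr mul0r.
  - by rewrite hornerM !(hornerD, hornerN, hornerXn, hornerC) expr1n subrr mul0r.
move=> [sp pm p1]; have [r pE] := poly_vanish R p pm p1.
have sr : (size r <= N)%N.
  have [->|r0] := eqVneq r 0; first by rewrite size_poly0.
  have z : (1 - 'X^2 : {poly R}) != 0 by rewrite -size_poly_gt0 size_oneBX2.
  by move: sp; rewrite pE size_mul // size_oneBX2 !addSn add0n.
have [c rE] := chS_span R N r sr; exists (fun k => - (c k / 2)) => /=.
rewrite pE rE big_distrr /=; apply: eq_bigr => k _.
rewrite chebphiE -!scalerAr scalerA; congr (_ *: _).
by rewrite mulrNN divfK // pnatr_eq0.
Qed.

Lemma poly_Usum p n : (size p <= n)%N -> exists c, p = Usum R c 0 n.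
Proof.
by move=> /(@chS_span R n p) [c ->]; exists c; rewrite /Usum big_mkord.
Qed.

Lemma in_V_poly_approx u du e : in_V u du -> 0 < e -> exists p, [/\ p.[-1] = 0, p.[1] = 0,
  nrm R one (fun x => p.[x] - u x) <= e & nrm R om (fun x => p^`().[x] - du x) <= e].
Proof.
move=> uV e0; have [hu hdu app] := in_V_approx R u du uV.
have [|phi [tphi n1 n2]] := app (e / 2); first by lra.
have [c1 c2 d1 pm p1] := test_fun_facts R phi tphi.
have [||p [qm q1 qa]] := poly_approx_derivable R phi (derive1 phi) (fun x _ _ => d1 x) _ pm p1
  (test_fun_Wc R phi tphi) (e / 4).
- exact: continuous_subspaceT.
- lra.
exists p; split => //.
- have hp := L2w_continuous R one phi w1 c1; have hq := L2w_poly R one p w1.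
  rewrite (eq_nrm _ _ _ (fun x => (p.[x] - phi x) + (phi x - u x))); last by move=> x _ _; ring.
  apply: (le_trans (nrmD _ _ w1 _ _ (L2wB _ _ w1 _ _ hq hp) (L2wB _ _ w1 _ _ hp hu))).
  have -> : e = 2 * (e / 4) + e / 2 by field.
  apply: lerD => //; apply: nrm_bounded => //; [lra|exact: (L2wB _ _ w1 _ _ hq hp).1|].
  by move=> x x1 x2; case: (qa x (ltW x1) (ltW x2)).
- have hp := L2w_continuous R om _ wo c2; have hq := L2w_poly R om p^`() wo.
  rewrite (eq_nrm _ _ _ (fun x => (p^`().[x] - derive1 phi x) + (derive1 phi x - du x))); last by move=> x _ _; ring.
  apply: (le_trans (nrmD _ _ wo _ _ (L2wB _ _ wo _ _ hq hp) (L2wB _ _ wo _ _ hp hdu))).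
  have -> : e = 2 * (e / 4) + e / 2 by field.
  apply: lerD => //; apply: nrm_bounded => //; [lra|exact: (L2wB _ _ wo _ _ hq hp).1|].
  by move=> x x1 x2; case: (qa x (ltW x1) (ltW x2)).
Qed.

Lemma expansion_best_approx du K p : L2w R om du -> (size p <= K)%N ->
  nrm R om (fun x => (Usum R (cf R du) 0 K).[x] - du x) <= nrm R om (fun x => p.[x] - du x).
Proof.
move=> hdu sp; set s := Usum _ _ _ _.
have hs := L2w_poly R om s wo; have hp := L2w_poly R om p wo.
have hsd := L2wB _ _ wo _ _ hs hdu; have hpd := L2wB _ _ wo _ _ hp hdu.
have orth q : (size q <= K)%N -> ip R om (fun x => s.[x] - du x) (horner q) = 0.
  move=> /poly_Usum [c ->]; rewrite ipBl //; last exact: L2w_poly.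
  rewrite !ip_Usum // -mulrBr -sumrB big_nat big1 ?mulr0 // => k kK.
  by rewrite cf_Usum kK subrr.
have ss : (size s <= K)%N.
  rewrite /s /Usum big_mkord; apply: (leq_trans (size_sum _ _ _)); apply/bigmax_leqP => k _.
  by apply: (leq_trans (size_scale_leq _ _)); rewrite size_chS.
set X := nrm R om _; set Y := nrm R om _.
have X0 : 0 <= X by exact: nrm_ge0.
have XY : X ^+ 2 <= X * Y.
  rewrite nrm_sqr //; apply: le_trans (ip_le_nrm _ _ wo _ _ hsd hpd); apply: le_trans (ler_norm _).
  set h := (fun x => s.[x] - du x) in hsd *.
  have o1 := orth s ss; have o2 := orth p sp.
  rewrite (ipC _ _ h (fun x => p.[x] - du x)) (ipBl _ _ wo _ _ h hp hdu hsd).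
  rewrite [leLHS](_ : _ = ip R om (horner s) h - ip R om du h); last exact: ipBl.
  by rewrite (ipC _ _ (horner s)) (ipC _ _ (horner p)) o1 o2.
have [XleY|YX] := leP X Y => //.
have : X * Y < X ^+ 2 by rewrite expr2 ltr_pM2l // (le_lt_trans _ YX) // nrm_ge0.
by rewrite ltNge XY.
Qed.

(** Completeness of the U_k is inherited from the density of polynomials in V, as partial sums are
    best approximations. The last bound is the form that u(1) = 0 takes, u having no point values
    here. *)
Lemma expansion_cvg u du e N : in_V u du -> 0 < e -> exists K, [/\ (N <= K)%N,
  nrm R om (fun x => (Usum R (cf R du) 0 K).[x] - du x) <= e,
  nrm R one (fun x => (Tsum R (cf R du) 0 K).[x] - u x) <= e &
  `|(Tsum R (cf R du) 0 K).[1]| <= e].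
Proof.
move=> uV e0; have [hu hdu _] := in_V_approx R u du uV.
have c0 := cP_ge0 R.
(* The derivatives of [w] and [p] differ by at most 2d, which [poincare] turns into 4 cP d; one more
   d separates p from u. *)
pose d := e / (1 + 4 * cP R); have dE : d * (1 + 4 * cP R) = e by rewrite divfK // gt_eqF //; lra.
have d0 : 0 < d by rewrite divr_gt0 //; lra.
have [p [pm p1 n1 n2]] := in_V_poly_approx u du d uV d0.
exists (maxn N (size p)); set K := maxn _ _.
pose s := Usum R (cf R du) 0 K; pose w := Tsum R (cf R du) 0 K; rewrite -/s -/w.
have sp : (size p^`() <= K)%N.
  apply: (leq_trans (size_poly _ _)); apply: (leq_trans (leq_pred _)); exact: leq_maxr.
have b1 := le_trans (expansion_best_approx du K p^`() hdu sp) n2; rewrite -/s in b1.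
have dw : (w - p)^`() = s - p^`() by rewrite derivB deriv_Tsum.
have wm : (w - p).[-1] = 0 by rewrite hornerD hornerN pm Tsum_N1 subrr.
have hs := L2w_poly R om s wo; have hp := L2w_poly R om p^`() wo.
have b2 : nrm R om (horner (w - p)^`()) <= 2 * d.
  rewrite dw (eq_nrm _ _ _ (fun x => (s.[x] - du x) - (p^`().[x] - du x))).
    apply: (le_trans (nrmB _ _ wo _ _ (L2wB _ _ wo _ _ hs hdu) (L2wB _ _ wo _ _ hp hdu))); lra.
  by move=> x _ _; rewrite hornerD hornerN; ring.
have b3 := ler_wpM2l c0 b2.
split.
- exact: leq_maxl.
- by apply: (le_trans b1); nra.
- have b4 := poincare R (w - p) wm.
  rewrite (eq_nrm _ _ _ (fun x => (w - p).[x] + (p.[x] - u x))); last first.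
    by move=> x _ _; rewrite hornerD hornerN; ring.
  apply: (le_trans (nrmD _ _ w1 _ _ (L2w_poly R one _ w1) (L2wB _ _ w1 _ _ (L2w_poly R one p w1) hu))).
  lra.
have -> : w.[1] = (w - p).[1] by rewrite hornerD hornerN p1 subr0.
have N11 : (-1 : R) <= 1 by lra.
apply: (le_trans (poincare_sup R (w - p) 1 wm N11 (lexx _))).
by apply: (le_trans b3); nra.
Qed.

(* [r] is the part of the Galerkin error in the polynomials of degree at most
   [N] that is orthogonal to [V_N]: it is controlled by its value at 1. *)
Lemma galerkin_boundary N r : (2 <= N)%N -> (size r <= N.+1)%N -> r.[-1] = 0 ->
  (forall q, in_VN N q -> ip R om (horner r^`()) (horner q^`()) = 0) ->
  nrm R om (horner r^`()) <= `|r.[1]|.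
Proof.
move=> N2 sr rm orth; set c := r.[1].
(* Removing the linear lift of r(1) lands in V_N, so orthogonality leaves ||r'||^2 = (c/2)(r', 1);
   the norm of 1 is at most 2, which cancels the 1/2. *)
pose q := r - (c / 2) *: ('X + 1).
have qV : in_VN N q.
  apply/in_VNP; first by lia.
  split.
  - apply: (leq_trans (size_polyD _ _)); rewrite geq_max sr size_polyN /=.
    apply: (leq_trans (size_scale_leq _ _)); rewrite -[1]opprK -polyCN size_XsubC; lia.
  - by rewrite /q !(hornerD, hornerN, hornerZ, hornerX, hornerC) rm; ring.
  - by rewrite /q !(hornerD, hornerN, hornerZ, hornerX, hornerC) -/c; field.
have hr := L2w_poly R om r^`() wo.
have hc : L2w R om one by apply: L2w_continuous => //; exact: cst_continuous.
have := orth q qV.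
have -> : ip R om (horner r^`()) (horner q^`()) =
   ip R om (horner r^`()) (horner r^`()) - (c / 2) * ip R om (horner r^`()) one.
  have := ipDl R om wo (horner r^`()) one (horner r^`()) 1 (- (c / 2)) hr hc hr.
  rewrite (ipC _ _ one) => h.
  rewrite -[RHS](_ : 1 * ip R om (horner r^`()) (horner r^`()) +
     - (c / 2) * ip R om (horner r^`()) one = _); last by rewrite mul1r mulNr.
  rewrite -h ipC; apply: eq_ip => // x _ _.
  rewrite /q derivB derivZ derivD derivX -polyC1 derivC addr0.
  by rewrite !(hornerD, hornerN, hornerZ, hornerC); ring.
rewrite -nrm_sqr // => /eqP; rewrite subr_eq0 => /eqP sq.
have n1 : nrm R om one <= 2 * 1.
  by apply: nrm_bounded => // x _ _; rewrite normr1.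
have cs := ip_le_nrm _ _ wo _ _ hr hc.
set X := nrm R om (horner r^`()) in sq cs *; have X0 : 0 <= X by exact: nrm_ge0.
have XX : X ^+ 2 <= `|c| * X.
  rewrite sq; apply: (le_trans (ler_norm _)); rewrite normrM normrM (@ger0_norm _ 2^-1) ?invr_ge0 //.
  have := ler_wpM2l X0 n1; have := normr_ge0 c; set C := `|c|; set Y := `|ip _ _ _ _| in cs *.
  move=> C0 h; have := ler_wpM2l C0 (le_trans cs h); lra.
have [//|cX] := leP X `|c|.
have Xp : 0 < X by exact: le_lt_trans cX.
by move: XX; rewrite expr2 ler_pM2r // leNgt cX.
Qed.

End GalerkinError.

(** * Rates for the tail of the expansion of an H^m function *)

Section SobolevTail.
Variable R : realType.
Local Open Scope classical_set_scope.
Local Open Scope ring_scope.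
Implicit Types (u du f g : R -> R) (i j k n K N m : nat) (D : nat -> R -> R).
Notation one := (fun=> 1 : R).
Notation om := (@omega R).

Let w1 := weight1 R.
Let wo := weight_omega R.
Let M0 := Mom_gt0 R.

Lemma normHm_ge m D j : (j <= m)%N -> (forall k, (k <= m)%N -> L2 (D k)) ->
  ip R om (D j) (D j) <= normHm m D ^+ 2.
Proof.
move=> jm hD; have hj := L2_L2w R (D j) (hD j jm).
have t0 k : 0 <= intI (fun x => D k x ^+ 2).
  by apply: Rintegral_ge0 => x _; exact: sqr_ge0.
have -> : normHm m D ^+ 2 = \sum_(k < m.+1) intI (fun x => D k x ^+ 2).
  by rewrite sqr_sqrtr // sumr_ge0.
apply: (@le_trans _ _ (intI (fun x => D j x ^+ 2))).
  have -> : intI (fun x => D j x ^+ 2) = ip R one (D j) (D j).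
    by apply: eq_intI => x _ _; ring.
  by rewrite -!nrm_sqr // lerXn2r ?nnegrE ?nrm_ge0 // nrm_omega_le.
have jm1 : (j < m.+1)%N by [].
by rewrite (bigD1 (Ordinal jm1)) //= lerDl sumr_ge0.
Qed.

Lemma sobolev_tail m : (2 <= m)%N -> exists2 C : R, 0 <= C &
  forall u du D N K, in_V u du -> in_Hm m u D -> (2 <= N)%N -> (N <= K)%N ->
  [/\ nrm R om (horner (Tsum R (cf R du) N K)^`()) <= C * N%:R ^- m.-1 * normHm m D,
      nrm R one (horner (Tsum R (cf R du) N K)) <= C * N%:R ^- m * normHm m D &
      `|(Tsum R (cf R du) N K).[1]| <= C * N%:R ^- m * normHm m D].
Proof.
(* From here on [m] is the original exponent minus 2: [dec1] gives decay of order m+1 for the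
   coefficients of u', and [dec2] of order m for those of u''. *)
case: m => [//|[//|m]] _ /=.
have [C1 C10 dec1] := coef_decay R m.+1; have [C2 C20 dec2] := coef_decay R m.
pose k1 := Num.sqrt (C1 / Mom R); pose k2 := Num.sqrt (C2 / Mom R).
have k10 : 0 <= k1 by exact: sqrtr_ge0.
have k20 : 0 <= k2 by exact: sqrtr_ge0.
have k1s : k1 ^+ 2 = C1 / Mom R by rewrite sqr_sqrtr // divr_ge0 // ltW.
have k2s : k2 ^+ 2 = C2 / Mom R by rewrite sqr_sqrtr // divr_ge0 // ltW.
pose sM := Num.sqrt (Mom R); have sM0 : 0 <= sM by exact: sqrtr_ge0.
have sMs : sM ^+ 2 = Mom R by rewrite sqr_sqrtr // ltW.
(* In turn: the energy norm of the tail, the Gram matrix bound (4 is the root of 16), and the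
   end-point sums, each at most 3 k2. *)
exists (sM * k1 + 4 * k1 + 12 * k2); first by rewrite !addr_ge0 // ?mulr_ge0.
move=> u du D N K uV [D0 [DL2 Dw]] N2 NK.
set H := normHm _ _; have H0 : 0 <= H by exact: sqrtr_ge0.
have HD j : (j <= m.+2)%N -> L2w R one (D j) by move=> jm; apply: L2_L2w; exact: DL2.
have cfD : cf R du = cf R (D 1%N).
  apply/funext => k; rewrite /cf; congr (_ / _).
  apply: (weak_deriv_in_V R u du (D 1%N) uV); first exact: HD.
  by have := Dw 0%N; rewrite D0; apply.
have bes j K' : (j <= m.+2)%N -> \sum_(0 <= k < K') cf R (D j) k ^+ 2 <= H ^+ 2 / Mom R.
  move=> jm; rewrite ler_pdivlMr // mulrC.
  apply: (le_trans (bessel R (D j) K' (L2w_omega R _ (HD j jm)))).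
  exact: normHm_ge.
have rec j k : (j < m.+2)%N ->
    cf R (D j) k.+1 = 2^-1 * (cf R (D j.+1) k / k.+1%:R - cf R (D j.+1) k.+2 / k.+3%:R).
  by move=> jm; apply: cf_weak; [apply: HD; exact: ltnW|exact: HD|exact: Dw].
have HM : 0 <= H ^+ 2 / Mom R by rewrite divr_ge0 ?sqr_ge0 // ltW.
have d1 n L : \sum_(n <= k < L) cf R (D 1%N) k ^+ 2 <= (k1 * H / n.+1%:R ^+ m.+1) ^+ 2.
  have := dec1 (fun l => cf R (D l.+1)) _ HM (fun l li K' => bes l.+1 K' li) (fun l li k => rec l.+1 k li) n L.
  move=> h; apply: (le_trans h); rewrite exprMn exprVn exprMn k1s -exprM muln2.
  by rewrite le_eqVlt; apply/orP; left; apply/eqP; ring.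
have d2 n L : \sum_(n <= k < L) cf R (D 2%N) k ^+ 2 <= (k2 * H / n.+1%:R ^+ m) ^+ 2.
  have := dec2 (fun l => cf R (D l.+2)) _ HM (fun l li K' => bes l.+2 K' li) (fun l li k => rec l.+2 k li) n L.
  move=> h; apply: (le_trans h); rewrite exprMn exprVn exprMn k2s -exprM muln2.
  by rewrite le_eqVlt; apply/orP; left; apply/eqP; ring.
rewrite cfD; set a := cf R (D 1%N) in d1 *.
have Np : 0 < N%:R :> R by rewrite ltr0n (ltnW N2).
have P0 j : 0 < N%:R ^+ j :> R by rewrite exprn_gt0.
have d1N : \sum_(N <= k < K) a k ^+ 2 <= (k1 * H / N%:R ^+ m.+1) ^+ 2.
  apply: (le_trans (d1 N K)).
  rewrite lerXn2r ?nnegrE ?divr_ge0 ?exprn_ge0 ?mulr_ge0 // ler_wpM2l ?mulr_ge0 //.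
  rewrite lef_pV2 ?posrE ?P0 ?exprn_gt0 ?ltr0n //.
  by rewrite lerXn2r ?nnegrE ?ler_nat.
set B := k2 * H / N%:R ^+ m; have B0 : 0 <= B by rewrite divr_ge0 ?mulr_ge0 // ltW.
have tailB s : s ^+ 2 = 1 ->
    `|\sum_(N <= k < K) a k * s ^+ k / k.+1%:R| <= 3 * B / N%:R ^+ 2.
  (* The start is [N.-1] because the bounded sum begins at its successor; the bound on a single
     coefficient of u'' is read off from a tail of squares containing it. *)
  move=> s2; have := tail_sum_bound R a (cf R (D 2%N)) s B N.-1 s2 (fun k => rec 1%N k isT).
  rewrite (prednK (ltnW N2)).
  apply=> k Nk; rewrite -(@ler_pXn2r _ 2) // ?nnegrE // real_normK ?num_real //.
  have := d2 N.-1 k.+1; rewrite (prednK (ltnW N2)).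
  apply: le_trans; rewrite big_nat_recr //= lerDr.
  by apply: sumr_ge0 => i _; exact: sqr_ge0.
have BE : B / N%:R ^+ 2 = k2 * H / N%:R ^+ m.+2.
  by rewrite /B -mulrA -invfM -exprD addn2.
have m1 : (-1) ^+ 2 = 1 :> R by rewrite sqrrN expr1n.
have t1 := tailB 1 (expr1n _ _); have t2 := tailB (-1) m1.
rewrite -mulrA BE in t1 t2.
set Z1 := \sum_(_ <= _ < _) _ in t1; set Z2 := \sum_(_ <= _ < _) _ in t2.
set W := H / N%:R ^+ m.+2.
have W0 : 0 <= W by rewrite divr_ge0 // ltW.
have kW : k2 * H / N%:R ^+ m.+2 = k2 * W by rewrite mulrA.
rewrite kW in t1 t2.
split.
- rewrite deriv_Tsum -(@ler_pXn2r _ 2) // ?nnegrE ?nrm_ge0 //; last first.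
    by rewrite !mulr_ge0 ?addr_ge0 ?mulr_ge0 // invr_ge0 ltW.
  rewrite nrm_Usum -sMs.
  apply: (@le_trans _ _ ((sM * (k1 * H / N%:R ^+ m.+1)) ^+ 2)).
    by rewrite [leRHS]exprMn ler_wpM2l ?sqr_ge0.
  have V0 : 0 <= H / N%:R ^+ m.+1 by rewrite divr_ge0 // ltW.
  have -> : sM * (k1 * H / N%:R ^+ m.+1) = (sM * k1) * (H / N%:R ^+ m.+1) by ring.
  have -> : (sM * k1 + 4 * k1 + 12 * k2) * N%:R ^- m.+1 * H =
     (sM * k1 + 4 * k1 + 12 * k2) * (H / N%:R ^+ m.+1) by ring.
  rewrite lerXn2r ?nnegrE ?mulr_ge0 ?addr_ge0 ?mulr_ge0 // ler_wpM2r // -addrA lerDl.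
  by rewrite addr_ge0 // mulr_ge0.
- have -> : (sM * k1 + 4 * k1 + 12 * k2) * N%:R ^- m.+2 * H =
     (sM * k1 + 4 * k1 + 12 * k2) * W by rewrite /W; ring.
  (* Only the T part goes through the Gram matrix; the constants that enforce the zero at -1 add up
     to [Z2], which telescoping controls. *)
  have TE : Tsum R a N K = \sum_(N <= k < K) (a k / k.+1%:R) *: chT R k.+1 + Z2%:P.
    rewrite /Tsum /Z2 raddf_sum -big_split /=; apply: eq_bigr => k _.
    rewrite scalerBr; congr (_ + _); rewrite exprS mulN1r polyCN scalerN opprK -mul_polyC -polyCM.
    by congr _%:P; ring.
  set P := \sum_(_ <= _ < _) _ in TE.
  have hP := L2w_poly R one P w1; have hZ := L2w_poly R one Z2%:P w1.
  rewrite TE (eq_nrm _ _ _ (fun x => P.[x] + (Z2%:P).[x])); last by move=> x _ _; rewrite hornerD.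
  apply: (le_trans (nrmD _ _ w1 _ _ hP hZ)).
  have n1 : nrm R one (horner Z2%:P) <= 2 * (3 * (k2 * W)).
    apply: nrm_bounded => //; first by rewrite !mulr_ge0.
    by case: hZ.
    by move=> x _ _; rewrite hornerC.
  have n2 : nrm R one (horner P) <= 4 * (k1 * W).
    rewrite -(@ler_pXn2r _ 2) // ?nnegrE ?nrm_ge0 ?mulr_ge0 //.
    apply: (le_trans (nrm_chT_sum R (fun k => a k / k.+1%:R) N K)).
    rewrite exprMn (_ : 4 ^+ 2 = 16 :> R); last by ring.
    apply: ler_wpM2l => //.
    apply: (@le_trans _ _ (N%:R ^- 2 * \sum_(N <= k < K) a k ^+ 2)).
      rewrite big_distrr /= big_nat [leRHS]big_nat; apply: ler_sum => k /andP[Nk _].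
      rewrite exprMn mulrC ler_wpM2r ?sqr_ge0 // exprVn lef_pV2 ?posrE ?P0 ?exprn_gt0 ?ltr0n //.
      by rewrite lerXn2r ?nnegrE // ler_nat leqW.
    apply: (@le_trans _ _ (N%:R ^- 2 * (k1 * H / N%:R ^+ m.+1) ^+ 2)).
      by rewrite ler_wpM2l // invr_ge0 ltW.
    have -> : N%:R ^- 2 * (k1 * H / N%:R ^+ m.+1) ^+ 2 = (k1 * W) ^+ 2.
      rewrite /W [N%:R ^+ m.+2]exprS; set y := N%:R ^+ m.+1.
      by field; rewrite (gt_eqF Np) (gt_eqF (P0 _)).
    exact: lexx.
  have p1 : 0 <= sM * k1 * W by rewrite !mulr_ge0.
  have p2 : 0 <= k2 * W by rewrite mulr_ge0.
  apply: (le_trans (lerD n2 n1)); lra.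
have -> : (sM * k1 + 4 * k1 + 12 * k2) * N%:R ^- m.+2 * H =
   (sM * k1 + 4 * k1 + 12 * k2) * W by rewrite /W; ring.
have -> : (Tsum R a N K).[1] = Z1 + Z2.
  rewrite /Tsum horner_sum /Z1 /Z2 -big_split /=; apply: eq_bigr => k _.
  rewrite hornerZ hornerD hornerN hornerC horner_chT1 expr1n exprS; ring.
have p1 : 0 <= sM * k1 * W by rewrite !mulr_ge0.
have p2 : 0 <= k1 * W by rewrite mulr_ge0.
have p3 : 0 <= k2 * W by rewrite mulr_ge0.
apply: (le_trans (ler_normD _ _)); apply: (le_trans (lerD t1 t2)); lra.
Qed.

End SobolevTail.

(** * Error bounds: the tail of the expansion plus the boundary defect *)

Theorem mainTheorem4 (R : realType) (m : nat) (hm : (2 <= m)%N) :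
  exists C : R, forall (f u du : R -> R) (D : nat -> R -> R) (N : nat) (uN : {poly R}),
    L2 f ->
    in_V u du ->
    (forall v dv, in_V v dv -> aform du dv = pairing f v) ->
    in_Hm m u D ->
    (2 <= N)%N ->
    in_VN N uN ->
    (forall q : {poly R}, in_VN N q ->
       aform (fun x => uN^`().[x]) (fun x => q^`().[x]) = pairing f (fun x => q.[x])) ->
    normV (fun x => du x - uN^`().[x]) <= C * (N%:R ^- (m.-1)) * normHm m D /\
    normL2 (fun x => u x - uN.[x]) <= C * (N%:R ^- m) * normHm m D.
Proof.
have [C C0 tail] := sobolev_tail R m hm.
have c0 := cP_ge0 R; have w1 := weight1 R; have wo := weight_omega R.
(* In the energy norm, C comes from the tail and C from its value at 1; in L^2 the latter passes
   through [poincare], hence 2 cP C. *)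
exists (2 * C + 2 * cP R * C) => f u du D N uN hf uV weak uH N2 uNV gal.
have NK0 : (0 < N)%N by exact: ltnW.
have [suN uNm uN1] := (in_VNP R N uN NK0).1 uNV.
have [hu hdu _] := in_V_approx R u du uV.
have galerkin q : in_VN N q ->
    ip R (@omega R) (horner uN^`()) (horner q^`()) = ip R (@omega R) du (horner q^`()).
  move=> qV; have [_ qm q1] := (in_VNP R N q NK0).1 qV.
  transitivity (pairing f (horner q)); first exact: gal.
  by rewrite -(weak _ _ (in_V_poly R q qm q1)).
set H := normHm m D; have H0 : 0 <= H by exact: sqrtr_ge0.
set Y := N%:R ^- m.-1 * H; set W := N%:R ^- m * H.
have W0 : 0 <= W by rewrite mulr_ge0 // invr_ge0 exprn_ge0.
have WY : W <= Y.
  rewrite ler_wpM2r // lef_pV2 ?posrE ?exprn_gt0 ?ltr0n //.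
  by rewrite ler_weXn2l ?ler1n // leq_pred.
pose a := cf R du; pose z := Tsum R a 0 N; pose r := z - uN.
have rm : r.[-1] = 0 by rewrite /r hornerD hornerN uNm Tsum_N1 subrr.
have r1 : r.[1] = z.[1] by rewrite /r hornerD hornerN uN1 subr0.
have sz : (size z <= N.+1)%N.
  rewrite /z /Tsum big_mkord; apply: (leq_trans (size_sum _ _ _)); apply/bigmax_leqP => k _.
  apply: (leq_trans (size_scale_leq _ _)); apply: (leq_trans (size_polyD _ _)).
  rewrite size_polyN geq_max (leq_trans (size_chT R _)) ?ltnS //=.
  by apply: (leq_trans (size_polyC_leq1 _)).
have sr : (size r <= N.+1)%N by rewrite (leq_trans (size_polyD _ _)) // geq_max size_polyN sz suN.
(* [z] and [uN] give the same form values on V_N: for [uN] by the Galerkin equation, for [z] because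
   z' projects [du] onto polynomials of degree below N, among them every q'. *)
have bnd : nrm R (@omega R) (horner r^`()) <= `|z.[1]|.
  rewrite -r1; apply: (galerkin_boundary R N r N2 sr rm) => q qV.
  have -> : r^`() = 1 *: z^`() + (-1) *: uN^`() by rewrite /r derivB scale1r scaleN1r.
  rewrite ipC ipD_poly //; last exact: L2w_poly.
  rewrite (ipC _ _ _ (horner uN^`())) (galerkin q qV) (ipC _ _ _ (horner z^`())).
  have [sq _ _] := (in_VNP R N q NK0).1 qV.
  have [|d ->] := poly_Usum R q^`() N.
    have [->|q0] := eqVneq q 0; first by rewrite deriv0 size_poly0.
    by rewrite -ltnS (leq_trans (lt_size_deriv q0)).
  rewrite deriv_Tsum !ip_Usum //; last exact: L2w_poly.
  rewrite mul1r mulN1r -mulrBr -sumrB big_nat big1 ?mulr0 // => k kN.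
  by rewrite cf_Usum kN subrr.
(* The error is r + t minus (z + t - u). The cut K of the tail depends on e, but the constants do
   not, so e can tend to 0 at the end. *)
have est e : 0 < e -> 
    nrm R (@omega R) (fun x => du x - uN^`().[x]) <= 2 * C * Y + 2 * e /\
    nrm R (fun=> 1) (fun x => u x - uN.[x]) <= (2 * C + 2 * cP R * C) * W + (1 + 2 * cP R) * e.
  move=> e0; have [K [NK k1 k2 k3]] := expansion_cvg R u du e N uV e0.
  have [t1 t2 t3] := tail u du D N K uV uH N2 NK.
  rewrite -/a in k1 k2 k3 t1 t2 t3; rewrite -/H -mulrA -/Y in t1.
  rewrite -/H -mulrA -/W in t2; rewrite -/H -mulrA -/W in t3.
  set t := Tsum R a N K in t1 t2 t3.
  have wE : Tsum R a 0 K = z + t by rewrite (@Tsum_cat R a 0 N K) //.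
  rewrite wE in k2 k3; rewrite -deriv_Tsum wE in k1.
  have z1 : `|z.[1]| <= e + C * W.
    have -> : z.[1] = (z + t).[1] - t.[1] by rewrite hornerD addrK.
    by apply: (le_trans (ler_normB _ _)); exact: lerD.
  have hzt := L2w_poly R (@omega R) (z + t)^`() wo.
  have ht := L2w_poly R (@omega R) t^`() wo; have hr := L2w_poly R (@omega R) r^`() wo.
  have hzt1 := L2w_poly R _ (z + t) w1.
  have ht1 := L2w_poly R _ t w1; have hr1 := L2w_poly R _ r w1.
  have CWY : C * W <= C * Y by rewrite ler_wpM2l.
  split.
    rewrite (eq_nrm _ _ _ (fun x => (r^`().[x] + t^`().[x]) - ((z + t)^`().[x] - du x))); last first.
      by move=> x _ _; rewrite /r derivB derivD !(hornerD, hornerN); ring.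
    have hrt : L2w R (@omega R) (fun x => r^`().[x] + t^`().[x]).
      by have := L2wD _ _ wo _ _ 1 1 hr ht; apply: eq_L2w => x _ _; ring.
    apply: (le_trans (nrmB _ _ wo _ _ hrt (L2wB _ _ wo _ _ hzt hdu))).
    have := nrmD _ _ wo _ _ hr ht; lra.
  rewrite (eq_nrm _ _ _ (fun x => (r.[x] + t.[x]) - ((z + t).[x] - u x))); last first.
    by move=> x _ _; rewrite /r !(hornerD, hornerN); ring.
  have hrt : L2w R (fun=> 1) (fun x => r.[x] + t.[x]).
    by have := L2wD _ _ w1 _ _ 1 1 hr1 ht1; apply: eq_L2w => x _ _; ring.
  apply: (le_trans (nrmB _ _ w1 _ _ hrt (L2wB _ _ w1 _ _ hzt1 hu))).
  have p1 := poincare R r rm; have p2 := ler_wpM2l c0 (le_trans bnd z1).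
  have := nrmD _ _ w1 _ _ hr1 ht1.
  have := mulr_ge0 C0 W0; lra.
have nVE : normV (fun x => du x - uN^`().[x]) = nrm R (@omega R) (fun x => du x - uN^`().[x]).
  by rewrite /normV /nrm; congr Num.sqrt; apply: eq_intI => x _ _; ring.
have nLE : normL2 (fun x => u x - uN.[x]) = nrm R (fun=> 1) (fun x => u x - uN.[x]).
  by rewrite /normL2 /nrm; congr Num.sqrt; apply: eq_intI => x _ _; ring.
rewrite nVE nLE -[X in _ <= X /\ _]mulrA -[X in _ /\ _ <= X]mulrA -/Y -/W.
split; apply/ler_addgt0Pr => e e0.
  have [|h _] := est (e / 2); first by rewrite divr_gt0.
  apply: (le_trans h); have cc := mulr_ge0 (mulr_ge0 c0 C0) (le_trans W0 WY); lra.
have [|_ h] := est (e / (1 + 2 * cP R)); first by rewrite divr_gt0 //; lra.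
by move: h; rewrite [_ * (e / _)]mulrC divfK // gt_eqF //; lra.
Qed.
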